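(* Let $n>1$ be an integer and let $Q\subset\mathbb{R}^n$ be a cube with sides parallel to the coordinate axes. Fix real numbers $p>1$, $q>1$ and $\eta>1$. Then there is a $\delta>1$ such that every weight $w\in RH_p^{\delta}(Q)$ satisfies $$\langle w\rangle_K\,\langle w^{1-q'}\rangle_K^{\,q-1}\le\eta$$ for every cube $K\subset Q$ with sides parallel to the coordinate axes (that is, $w\in A_q^{\eta}(Q)$).
   Context: A weight is a non-negative measurable function. For a bounded cube $K$, $|K|$ is its Lebesgue measure and $\langle f\rangle_K=\frac{1}{|K|}\int_K f$. The conjugate exponent of $q$ is $q'=\frac{q}{q-1}$; negative powers of $0$ are $+\infty$. For $\delta\ge1$, $RH_p^{\delta}(Q)$ is the class of weights $w$ on $Q$ such that $0<\langle w\rangle_K<\infty$ and $\dfrac{\langle w^p\rangle_K^{1/p}}{\langle w\rangle_K}\le\delta$ for every cube $K\subset Q$ with sides parallel to the coordinate axes. *)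

(* Defs.v *)
From HB Require Import structures.
From mathcomp Require Import all_boot all_order all_algebra.
From mathcomp Require Import all_classical all_reals all_analysis.
Set Implicit Arguments.
Unset Strict Implicit.
Unset Printing Implicit Defensive.
Import Order.TTheory GRing.Theory Num.Theory.
Import numFieldNormedType.Exports.
Local Open Scope classical_set_scope.
Local Open Scope ring_scope.

(* [measurableTypeR R] is the carrier of the library's [lebesgue_measure] on the
   Borel subsets of [R]; tuples over it carry the product sigma-algebra. *)
Local Notation Rtuple R n := (n.-tuple (measurableTypeR R)).

Definition tuple_cons (R : realType) (n : nat)
    (x : measurableTypeR R * Rtuple R n) : Rtuple R n.+1 :=
  [tuple of x.1 :: x.2].

Fixpoint borel_lebesgue (R : realType) (n : nat) : set (Rtuple R n) -> \bar R :=
  match n with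
  | 0 => dirac [tuple]
  | m.+1 =>
      pushforward (lebesgue_measure \x @borel_lebesgue R m)%E (@tuple_cons R m)
  end.

Lemma measurable_tuple_cons (R : realType) (n : nat) :
  measurable_fun setT (@tuple_cons R n).
Proof. exact: measurable_cons. Qed.

Section borel_lebesgue_step.
Context (R : realType) (n : nat).
Variable mu : {sigma_finite_measure set (Rtuple R n) -> \bar R}.

Let step : set (Rtuple R n.+1) -> \bar R :=
  pushforward (lebesgue_measure \x mu)%E (@tuple_cons R n).

Let step_measure : {nu : {measure set (Rtuple R n.+1) -> \bar R} |
  nu = step :> (set _ -> _)}.
Proof.
by eexists (measure_function_pushforward__canonical__measure_function_Measure
  (lebesgue_measure \x mu)%E (@measurable_tuple_cons R n)).
Qed.

Let step0 : step set0 = 0%E.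
Proof. by have [nu <-] := step_measure. Qed.

Let step_ge0 A : (0 <= step A)%E.
Proof. by have [nu <-] := step_measure. Qed.

Let step_sigma_additive : semi_sigma_additive step.
Proof. by have [nu <-] := step_measure; exact: measure_semi_sigma_additive. Qed.

HB.instance Definition _ := isMeasure.Build _ _ _ step
  step0 step_ge0 step_sigma_additive.

Let step_sigma_finite : sigma_finite setT step.
Proof.
have /sigma_finiteP[F [TF ndF Foo]] := sigma_finiteT (@lebesgue_measure R).
have /sigma_finiteP[G [TG ndG Goo]] := sigma_finiteT mu.
pose u (t : Rtuple R n.+1) := (thead t, [tuple of behead t]).
have uK : cancel (@tuple_cons R n) u.
  by move=> [x t]; congr (_, _); exact/val_inj.
have mu_ : measurable_fun setT u.
  apply/measurable_fun_pairP; split; first exact: measurable_tnth.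
  exact: measurable_behead.
exists (fun k => u @^-1` (F k `*` G k)) => [|k].
  apply/esym; rewrite -subTset => t _.
  have [i _ Fi] : (\bigcup_k F k) (u t).1 by rewrite -TF.
  have [j _ Gj] : (\bigcup_k G k) (u t).2 by rewrite -TG.
  exists (maxn i j) => //; split.
    by move: Fi; apply/subsetPset/ndF/leq_maxl.
  by move: Gj; apply/subsetPset/ndG/leq_maxr.
have [[mF Fk] [mG Gk]] := (Foo k, Goo k); split.
  by rewrite -[X in measurable X]setTI; apply: mu_ => //; exact: measurableX.
rewrite /step /pushforward -comp_preimage (_ : u \o _ = id) ?preimage_id.
  by rewrite [ltLHS]product_measure1E// lte_mul_pinfty// ge0_fin_numE.
by apply/funext => x /=; rewrite uK.
Qed.

HB.instance Definition _ := Measure_isSigmaFinite.Build _ _ _ step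
  step_sigma_finite.

Lemma borel_lebesgue_step :
  {nu : {sigma_finite_measure set (Rtuple R n.+1) -> \bar R} |
    nu = pushforward (lebesgue_measure \x mu)%E (@tuple_cons R n)
      :> (set _ -> _)}.
Proof. by exists step. Qed.

End borel_lebesgue_step.

Section borel_lebesgue_measure.
Context (R : realType) (n : nat).

Let borel_lebesgue_measure :
  {mu : {sigma_finite_measure set (Rtuple R n) -> \bar R} |
    mu = @borel_lebesgue R n :> (set _ -> _)}.
Proof.
elim: n => [|m [mu muE]]; first by exists (dirac [tuple]).
by have [nu nuE] := borel_lebesgue_step mu; exists nu; rewrite nuE muE.
Qed.

Let mu0 : @borel_lebesgue R n set0 = 0%E.
Proof. by have [mu <-] := borel_lebesgue_measure. Qed.

Let mu_ge0 A : (0 <= @borel_lebesgue R n A)%E.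
Proof. by have [mu <-] := borel_lebesgue_measure. Qed.

Let mu_sigma_additive : semi_sigma_additive (@borel_lebesgue R n).
Proof.
by have [mu <-] := borel_lebesgue_measure; exact: measure_semi_sigma_additive.
Qed.

HB.instance Definition _ := isMeasure.Build _ _ _ (@borel_lebesgue R n)
  mu0 mu_ge0 mu_sigma_additive.

Let mu_sigma_finite : sigma_finite setT (@borel_lebesgue R n).
Proof. by have [mu <-] := borel_lebesgue_measure; exact: sigma_finiteT. Qed.

HB.instance Definition _ := Measure_isSigmaFinite.Build _ _ _
  (@borel_lebesgue R n) mu_sigma_finite.

End borel_lebesgue_measure.

(* R^n with its Lebesgue sigma-algebra, i.e., the sets that are Caratheodory
   measurable for the outer measure induced by [borel_lebesgue]; [lebesgue] is
   the restriction of that outer measure, i.e., the completion of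
   [borel_lebesgue]. *)
Definition euclidean (R : realType) (n : nat) : Type :=
  caratheodory_type ((@borel_lebesgue R n)^*)%mu.

HB.instance Definition _ (R : realType) (n : nat) :=
  Measurable.on (euclidean R n).

Definition lebesgue (R : realType) (n : nat) : set (euclidean R n) -> \bar R :=
  @completed_measure_extension _ _ _ (@borel_lebesgue R n).

HB.instance Definition _ (R : realType) (n : nat) :=
  Measure.on (@lebesgue R n).

(* Cubes are closed, bounded and nondegenerate, with sides parallel to the
   coordinate axes. *)
Definition cube (R : realType) (n : nat) (a : n.-tuple R) (l : R) :
    set (euclidean R n) :=
  [set x | forall i : 'I_n,
     tnth a i <= tnth (x : n.-tuple R) i <= tnth a i + l].

Definition is_cube (R : realType) (n : nat) (K : set (euclidean R n)) : Prop :=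
  exists a : n.-tuple R, exists2 l : R, 0 < l & K = cube a l.

Section lebesgue_cube.
Context (R : realType).

Lemma borel_measurable_cube (n : nat) (a : n.-tuple R) (l : R) :
  measurable (cube a l : set (Rtuple R n)).
Proof.
rewrite (_ : cube a l = \big[setI/setT]_(i < n)
    ((@tnth _ (measurableTypeR R))^~ i @^-1` `[tnth a i, tnth a i + l])).
  apply: big_ind => //; first exact: measurableI.
  move=> i _; rewrite -[X in measurable X]setTI.
  by apply: measurable_tnth => //; exact: measurable_itv.
apply/seteqP; split => x.
  move=> h; apply: (big_ind (fun A : set _ => A x)) => // i _ /=.
  by rewrite in_itv/=; exact: h.
by move=> h i; move: h; rewrite (bigD1 i)//= => -[]; rewrite /= in_itv.
Qed.

Let borel_lebesgue_cube (n : nat) (a : n.-tuple R) (l : R) : 0 < l ->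
  borel_lebesgue (cube a l : set (Rtuple R n)) = (l ^+ n)%:E.
Proof.
move=> l0; elim: n a => [|n ih] a.
  by rewrite /= diracE mem_set ?expr0// => -[].
rewrite /= /pushforward.
have -> : @tuple_cons R n @^-1` cube a l =
    `[thead a, thead a + l] `*` cube [tuple of behead a] l.
  have tE (i : 'I_n) : tnth [tuple of behead a] i = tnth a (lift ord0 i).
    by rewrite [in RHS](tuple_eta a) tnthS.
  apply/seteqP; split => -[x t] /=.
    move=> h; split; first by have := h ord0; rewrite in_itv.
    by move=> i; have := h (lift ord0 i); rewrite tE /tuple_cons/= tnthS.
  rewrite in_itv /= => -[h1 h2] i.
  have [j ->|->] := unliftP ord0 i; last exact: h1.
  by have := h2 j; rewrite tE /tuple_cons /= tnthS.
rewrite [LHS]product_measure1E//; last exact: borel_measurable_cube.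
have E : lebesgue_measure `[thead a, thead a + l]%classic = l%:E :> \bar R.
  by rewrite lebesgue_measure_itv/= lte_fin ltrDl l0 -EFinD addrC addKr.
rewrite [X in (_ * X)%E]ih [X in (X * _)%E](_ : _ = l%:E); last exact: E.
by rewrite -EFinM exprS.
Qed.

Lemma measurable_cube (n : nat) (a : n.-tuple R) (l : R) :
  measurable (cube a l).
Proof.
exact: (caratheodory_measurable_mu_ext (@borel_lebesgue R n)
  (borel_measurable_cube a l)).
Qed.

Lemma lebesgue_cube (n : nat) (a : n.-tuple R) (l : R) : 0 < l ->
  lebesgue (cube a l) = (l ^+ n)%:E.
Proof.
move=> /(borel_lebesgue_cube a) <-.
exact: (measurable_mu_extE (@borel_lebesgue R n) (borel_measurable_cube a l)).
Qed.

End lebesgue_cube.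

Local Open Scope ereal_scope.

Definition avg (R : realType) (n : nat) (f : euclidean R n -> \bar R)
    (K : set (euclidean R n)) : \bar R :=
  (lebesgue K)^-1 * \int[@lebesgue R n]_(x in K) f x.

(* The library's [x `^ r] is 0 at [x = 0] and +oo at [x = +oo] for [r < 0];
   here negative powers of 0 are +oo and negative powers of +oo are 0. *)
Definition epow (R : realType) (x : \bar R) (r : R) : \bar R :=
  if (r < 0)%R then (x `^ (- r))^-1 else x `^ r.

Definition conjugate_exponent (R : realType) (q : R) : R := (q / (q - 1))%R.

Definition weight (R : realType) (n : nat) (Q : set (euclidean R n))
    (w : euclidean R n -> R) : Prop :=
  measurable_fun Q w /\ (forall x, Q x -> 0 <= w x)%R.

Definition reverse_holder (R : realType) (n : nat) (p delta : R)
    (Q : set (euclidean R n)) (w : euclidean R n -> R) : Prop :=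
  weight Q w /\
  forall K : set (euclidean R n), is_cube K -> K `<=` Q ->
    0 < avg (EFin \o w) K < +oo /\
    epow (avg (fun x => epow (w x)%:E p) K) p^-1 / avg (EFin \o w) K
      <= delta%:E.

(* Main.v *)
(* For small eps, a Bellman function
     B(x, y) = x^(-s) (1 + M e - N e^2),  e = y / x^p - 1 in [0, eps],
   with s = 1/(q-1), is concave along the splitting of a cube into its 2^n
   children, where x and y are the means of w and w^p: expanding around the mean,
   the M term absorbs the second order loss from x^(-s), and the -N e^2 term
   absorbs the cross terms, whose first order part has zero sum.  Iterating
   over dyadic generations bounds the mean of w_m^(-s), where w_m is w averaged
   on the dyadic cubes of generation m, by a constant close to 1 times
   (mean of w)^(-s).  As the sets well approximated by unions of dyadic cubes
   form a sigma-algebra, w_m tends to w in L^1, and x |-> max(x, k)^(-s) is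
   Lipschitz and smaller than x^(-s), so the bound passes to max(w, k)^(-s);
   then k tends to 0 by monotone convergence. *)
Require Import Defs.
From mathcomp Require Import all_boot all_order all_algebra.
From mathcomp Require Import all_classical all_reals all_analysis.
From mathcomp Require Import measurable_realfun.
From mathcomp Require Import ring lra.
Set Implicit Arguments.
Unset Strict Implicit.
Unset Printing Implicit Defensive.
Import Order.TTheory GRing.Theory Num.Theory.
Import numFieldNormedType.Exports.
Local Open Scope classical_set_scope.
Local Open Scope ring_scope.

(** * Tangent and second order bounds for powers *)

Section powR_bounds.
Context {R : realType}.
Implicit Types e p r s t u v x y : R.

Lemma powRV u r : 0 <= u -> u^-1 `^ r = (u `^ r)^-1.
Proof. by move=> u0; rewrite -powR_inv1// powRAC powR_inv1// powR_ge0. Qed.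

Lemma powR_le_tangent u r : 0 <= u -> 0 < r <= 1 -> u `^ r <= 1 + r * (u - 1).
Proof.
rewrite le_eqVlt => /predU1P[<- /andP[r0 r1]|u0 /andP[r0 r1]].
  by rewrite powR0 ?gt_eqF//; lra.
set v := 1 + _; have v0 : 0 < v by rewrite /v; nra.
rewrite -(lnK (v0 : v \in Num.pos)) /powR gt_eqF// ler_expR.
(* Concavity of ln: average the bounds h1 and h2 with weights r and 1 - r. *)
have h1 : 1 + (ln u - ln v) <= u / v.
  rewrite -ln_div// (le_trans (expR_ge1Dx _))// lnK// posrE divr_gt0//.
have h2 : 1 - ln v <= v^-1.
  rewrite -lnV// (le_trans (expR_ge1Dx _))// lnK// posrE invr_gt0//.
have e : r * (u / v) + (1 - r) * v^-1 = 1.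
  by rewrite /v; field; rewrite -/v gt_eqF.
nra.
Qed.

(** The concave bound above, applied to u^p with exponent 1/p and solved for u^p. *)
Lemma powR_ge_tangent u p : 0 <= u -> 1 <= p -> 1 + p * (u - 1) <= u `^ p.
Proof.
move=> u0 p1; have p0 : 0 < p by lra.
have := @powR_le_tangent (u `^ p) p^-1 (powR_ge0 _ _).
rewrite invr_gt0 p0 invf_le1// p1 => /(_ isT).
rewrite -powRrM mulfV ?gt_eqF// powRr1// -(ler_pM2l p0) mulrDr mulrA mulfV ?gt_eqF//.
by rewrite mulr1 mul1r; lra.
Qed.

Lemma powRN_ge_tangent u s : 0 < u -> 0 <= s -> 1 - s * (u - 1) <= u `^ (- s).
Proof.
move=> u0 s0; rewrite /powR gt_eqF// (le_trans _ (expR_ge1Dx _))//.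
have := le_ln1Dx (x := u - 1); rewrite addrCA subrr addr0 => h.
have {}h : ln u <= u - 1 by apply: h; lra.
nra.
Qed.

(** Strong convexity of the power around 1. The range is bounded by [B] because for p < 2 a
    quadratic outgrows t^p at infinity. *)
Lemma powR_quad_lower p B : 1 < p -> 0 < B -> exists2 c, 0 < c &
  forall t, 0 < t <= B -> 1 + p * (t - 1) + c * (t - 1) ^+ 2 <= t `^ p.
Proof.
move=> p1 B0; have [p2|p2] := leP p 2; last first.
  (* Bernoulli for t^2 with exponent p/2 gives exactly this quadratic term. *)
  exists (p / 2) => [|t /andP[t0 tB]]; first lra.
  have e : (t ^+ 2) `^ (p / 2) = t `^ p.
    by rewrite -(@powR_mulrn _ t 2) ?ltW// -powRrM; congr powR; field.
  by have := @powR_ge_tangent (t ^+ 2) (p / 2) (sqr_ge0 _); rewrite e; nra.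
pose r := p - 1; have r0 : 0 < r by rewrite /r; lra.
have r1 : r <= 1 by rewrite /r; lra.
exists (r ^+ 2 / (1 + B)) => [|t /andP[t0 tB]].
  by rewrite divr_gt0 ?exprn_gt0//; lra.
pose v := 1 + (1 - r) * (t - 1).
have v0 : 0 < v by rewrite /v; nra.
have vB : v <= 1 + B by rewrite /v; nra.
(* The tangent bound at 1/t reads t^(-r) <= v / t. Multiplying by t leaves t^2 / v, whose expansion
   at 1 has the explicit remainder r^2 (t - 1)^2 / v. *)
have h : t / v <= t `^ r.
  have := @powR_le_tangent t^-1 r; rewrite invr_ge0 ltW// r0 r1 => /(_ isT isT).
  rewrite (powRV _ (ltW t0)) => h.
  have e : 1 + r * (t^-1 - 1) = (t / v)^-1.
    by rewrite invf_div /v; field; rewrite gt_eqF.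
  by move: h; rewrite e lef_pV2// posrE ?powR_gt0 ?divr_gt0.
have -> : t `^ p = t * t `^ r by rewrite /r mulr_powRB1 ?ltW//; lra.
apply: (@le_trans _ _ (t * (t / v))); last by rewrite ler_pM2l.
have -> : t * (t / v) = 1 + p * (t - 1) + r ^+ 2 / v * (t - 1) ^+ 2.
  by rewrite /v /r; field; rewrite gt_eqF.
rewrite lerD2l ler_wpM2r ?sqr_ge0// ler_wpM2l ?sqr_ge0//.
by rewrite lef_pV2 ?posrE//; lra.
Qed.

Lemma powRN_quad_upper s : 0 < s -> exists C theta, [/\ 0 < C, 0 < theta &
  forall t, `|t - 1| <= theta -> 0 < t /\
    t `^ (- s) <= 1 - s * (t - 1) + C * (t - 1) ^+ 2].
Proof.
move=> s0; have h0 : 0 < 2 * (1 + s) by lra.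
(* The radius keeps [t] and [1 + s * (t - 1)] at least 1/2, so that their inverses in the two
   remainders are at most 2. *)
exists (2 * s * (1 + s)), (2 * (1 + s))^-1; split; [nra|by rewrite invr_gt0|].
move=> t; rewrite -div1r ler_pdivlMr// => h.
have ht : - 1 <= 2 * (1 + s) * (t - 1).
  by have := ler_norm (- (t - 1)); rewrite normrN; nra.
have t0 : 1 / 2 <= t by nra.
split; first lra.
have tp : 0 < t by lra.
have [s1|s1] := leP s 1.
  have := @powR_le_tangent t^-1 s; rewrite invr_ge0 ltW// s0 s1 => /(_ isT isT).
  rewrite (powRV _ (ltW tp)) -powRN => /le_trans; apply.
  rewrite -subr_ge0.
  have -> : 1 - s * (t - 1) + 2 * s * (1 + s) * (t - 1) ^+ 2 -
    (1 + s * (t^-1 - 1)) = s * (t - 1) ^+ 2 * (2 * (1 + s) - t^-1).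
    by field; rewrite gt_eqF.
  rewrite mulr_ge0//; first by rewrite mulr_ge0 ?sqr_ge0 ?ltW.
  by rewrite subr_ge0 -div1r ler_pdivrMr//; nra.
have v0 : 1 / 2 <= 1 + s * (t - 1) by nra.
have := @powR_ge_tangent t s; rewrite ltW// ltW// => /(_ isT isT) h1.
rewrite powRN (@le_trans _ _ (1 + s * (t - 1))^-1)//.
  by rewrite lef_pV2 ?posrE ?powR_gt0//; lra.
rewrite -subr_ge0.
have -> : 1 - s * (t - 1) + 2 * s * (1 + s) * (t - 1) ^+ 2 - (1 + s * (t - 1))^-1 =
  (t - 1) ^+ 2 * s * (2 * (1 + s) - s / (1 + s * (t - 1))).
  by field; rewrite gt_eqF//; lra.
rewrite mulr_ge0//; first by rewrite mulr_ge0 ?sqr_ge0 ?ltW.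
by rewrite subr_ge0 ler_pdivrMr; nra.
Qed.

Lemma powR_gt1 x s : 1 < x -> 0 < s -> 1 < x `^ s.
Proof.
move=> x1 s0; have <- : 1 `^ s = 1 :> R by rewrite powR1.
by rewrite gt0_ltr_powR// nnegrE// (le_trans ler01)// ltW.
Qed.

Lemma powRN_antitone s x y : 0 < s -> 0 < x -> x <= y ->
  y `^ (- s) <= x `^ (- s).
Proof.
move=> s0 x0 xy; have y0 := lt_le_trans x0 xy.
rewrite !powRN lef_pV2 ?posrE ?powR_gt0// ge0_ler_powR// ?nnegrE; exact: ltW.
Qed.

(** If x is below t = max(v, e), monotonicity suffices. Otherwise the convex function x^(-s) lies
    above its tangent at t, whose slope is at most s e^(-s) / e in size because e <= t. The point x
    stays untruncated so that it can later be a mean of the weight. *)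
Lemma powRN_max_le s e x v : 0 < s -> 0 < e -> 0 < x ->
  Num.max v e `^ (- s) <= x `^ (- s) + s * e `^ (- s) / e * `|v - x|.
Proof.
move=> s0 e0 x0; set t := Num.max v e.
have et : e <= t by rewrite le_max lexx orbT.
have vt : v <= t by rewrite le_max lexx.
have t0 := lt_le_trans e0 et.
have [xt|tx] := leP x t.
  apply: le_trans (powRN_antitone s0 x0 xt) _.
  by rewrite lerDl !mulr_ge0 ?powR_ge0 ?invr_ge0 ?(ltW s0) ?(ltW e0).
have := powRN_ge_tangent (divr_gt0 x0 t0) (ltW s0).
have ts0 : 0 < t `^ (- s) by rewrite powR_gt0.
rewrite -(ler_pM2r ts0) -powRM ?(ltW t0) ?divr_ge0 ?(ltW x0) ?(ltW t0)//.
rewrite divfK ?gt_eqF// => h.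
have {}h : t `^ (- s) <= x `^ (- s) + s * (t `^ (- s) / t) * (x - t).
  apply: le_trans (lerD h (lexx _)); rewrite le_eqVlt; apply/orP; left; apply/eqP.
  by field; rewrite gt_eqF.
apply: (le_trans h); rewrite lerD2l -!mulrA ler_pM2l// !mulrA ler_pM//.
- by rewrite divr_ge0// ltW.
- by rewrite subr_ge0 ltW.
- by rewrite ler_pM ?powR_ge0 ?invr_ge0 ?(ltW t0)// ?powRN_antitone// lef_pV2.
by rewrite distrC (le_trans _ (ler_norm _))// lerD2l lerN2.
Qed.

End powR_bounds.

(** * The Bellman function *)

Section bellman.
Context {R : realType}.
Variables p s M N : R.

(** The argument is the excess of y / x^p over 1, which measures how far the weight is from constant
    on a cube. *)
Definition gain (e : R) : R := 1 + M * e - N * e ^+ 2.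

Definition bellman (x y : R) : R := x `^ (- s) * gain (y / x `^ p - 1).

(* M and N are such that the losses are at most the quadratic form
   C d^2 + a d u + N u^2 with |a| <= M (p + s), in the deviations d = t_i - 1 and
   u = e_i - (mean of e), which is nonnegative by the equation on N. *)
Lemma sum_bellman_normalized (I : finType) (c C theta eps : R) (t e : I -> R) (E : R) :
  0 < c -> 0 < C -> 0 < theta -> 0 < p -> 0 < s ->
  M = 6 * C / c -> 4 * C * N = (M * (p + s)) ^+ 2 ->
  (forall u, 0 < u <= #|I|%:R -> 1 + p * (u - 1) + c * (u - 1) ^+ 2 <= u `^ p) ->
  (forall u, `|u - 1| <= theta ->
    u `^ (- s) <= 1 - s * (u - 1) + C * (u - 1) ^+ 2) ->
  M * eps <= 1 -> 4 * N * eps <= M -> #|I|%:R * eps <= c * theta ^+ 2 ->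
  (forall i, 0 < t i) -> (forall i, 0 <= e i <= eps) -> 0 <= E <= eps ->
  \sum_i t i = #|I|%:R -> \sum_i (t i `^ p * (1 + e i)) = #|I|%:R * (1 + E) ->
  \sum_i (t i `^ (- s) * gain (e i)) <= #|I|%:R * gain E.
Proof.
move=> c0 C0 th0 p0 s0 ME NE lower upper Meps Neps keps t0 e0 /andP[E0 E1] tI teI.
have M0 : 0 < M by rewrite ME; apply: divr_gt0 => //; lra.
have N0 : 0 < N.
  by have : 0 < 4 * C * N; [rewrite NE exprn_gt0// mulr_gt0//; lra|nra].
have sum1 (a : R) : \sum_(i : I) a = #|I|%:R * a by rewrite sumr_const mulr_natl.
have tle i : t i <= #|I|%:R.
  by rewrite -tI (bigD1 i)//= lerDl sumr_ge0// => j _; exact/ltW.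
have tp i : 1 + p * (t i - 1) + c * (t i - 1) ^+ 2 <= t i `^ p.
  by apply: lower; rewrite t0 tle.
have [k0|k0] := eqVneq #|I| 0%N.
  rewrite big_pred0 ?k0 ?mul0r// => i.
  by move: (card0_eq k0 i); rewrite inE.
have {k0}k0 : 0 < #|I|%:R :> R by rewrite ltr0n lt0n.
(* The terms t_i^p (1 + e_i) - 1 - p (t_i - 1) are at least c (t_i - 1)^2 and sum to |I| E, so a
   small [eps] forces every t_i close to 1. *)
have dle i : `|t i - 1| <= theta.
  have h : c * (t i - 1) ^+ 2 <= #|I|%:R * E.
    have -> : #|I|%:R * E = \sum_j (t j `^ p * (1 + e j) - 1 - p * (t j - 1)).
      rewrite !sumrB teI -mulr_sumr sumrB tI sum1; ring.
    rewrite (bigD1 i)//= -[leLHS]addr0 lerD// ?sumr_ge0// => [|j _].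
      by have := tp i; have /andP[] := e0 i; have := powR_ge0 (t i) p; nra.
    have := tp j; have /andP[] := e0 j; have := powR_ge0 (t j) p.
    by have := sqr_ge0 (t j - 1); nra.
  have {}h : (t i - 1) ^+ 2 <= theta ^+ 2.
    by rewrite -(ler_pM2l c0) (le_trans h)// (le_trans _ keps)// ler_pM2l.
  by rewrite -ler_sqr ?nnegrE ?(ltW th0)// real_normK ?num_real.
pose eb := (\sum_i e i) / #|I|%:R.
have ebE : \sum_i e i = #|I|%:R * eb by rewrite /eb mulrC divfK// gt_eqF.
have eb0 : 0 <= eb by rewrite divr_ge0 ?sumr_ge0// ?ltW// => i _; case/andP: (e0 i).
have eb1 : eb <= eps.
  rewrite ler_pdivrMr// mulrC -sum1 ler_sum// => i _; by case/andP: (e0 i).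
(* Chord slope of the parabola: [gain E - gain eb = sg * (E - eb)]. Below, [tau] is the chord slope
   between [eb] and [e i], while [M - 2 * N * eb] is the derivative at [eb]. *)
pose sg := M - N * (E + eb).
have sg0 : M / 2 <= sg by rewrite /sg; nra.
have sg1 : sg <= M by rewrite /sg; nra.
(* The deviations have zero sum, so that the sum of rhs is exactly |I| gain E. *)
pose rhs i := gain eb - s * gain eb * (t i - 1) + (M - 2 * N * eb) * (e i - eb) +
  sg * ((t i `^ p * (1 + e i)) - 1 - e i - p * (1 + eb) * (t i - 1)).
have -> : #|I|%:R * gain E = \sum_i rhs i.
  pose a0 := gain eb + s * gain eb - (M - 2 * N * eb) * eb - sg + sg * p * (1 + eb).
  pose a1 := - s * gain eb - sg * p * (1 + eb).
  pose a2 := M - 2 * N * eb - sg.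
  rewrite (eq_bigr (fun i => a0 + a1 * t i + a2 * e i + sg * (t i `^ p * (1 + e i)))).
    rewrite 3!big_split /= sum1 -!mulr_sumr teI ebE tI /a0 /a1 /a2 /sg /gain; ring.
  by move=> i _; rewrite /rhs /a0 /a1 /a2; ring.
apply: ler_sum => i _; rewrite /rhs.
have /andP[ei0 ei1] := e0 i.
have := upper _ (dle i); have := tp i; have := powR_ge0 (t i) p.
set d := t i - 1; set T := t i `^ p; set S := t i `^ (- s); set f := e i.
move=> T0 Tl Su.
have Nf : 4 * N * f <= M by apply: le_trans Neps; rewrite ler_pM2l// mulr_gt0.
have Mf : M * f <= 1 by apply: le_trans Meps; rewrite ler_pM2l.
have G0 : 0 <= gain f.
  have : 0 <= f * (M - 4 * N * f) by rewrite mulr_ge0// subr_ge0.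
  by rewrite /gain; nra.
have G2 : gain f <= 2 by rewrite /gain; nra.
pose u := f - eb; pose tau := M - N * (f + eb).
have tau0 : 0 <= tau by rewrite /tau; nra.
have tau1 : tau <= M by rewrite /tau gerBl mulr_ge0 ?addr_ge0 ?(ltW N0).
pose a := sg * p + s * tau.
have sgge0 : 0 <= sg by apply: le_trans sg0; rewrite divr_ge0// ltW.
have a0 : 0 <= a by rewrite /a addr_ge0// mulr_ge0// ltW.
have a1 : a <= M * (p + s).
  by rewrite mulrDr lerD// 1?[s * _]mulrC ler_pM2r.
have quad : 0 <= C * d ^+ 2 + a * (d * u) + N * u ^+ 2.
  rewrite -(@pmulr_rge0 _ (4 * C)); last lra.
  have -> : 4 * C * (C * d ^+ 2 + a * (d * u) + N * u ^+ 2) =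
    (2 * C * d + a * u) ^+ 2 + (4 * C * N - a ^+ 2) * u ^+ 2 by ring.
  rewrite addr_ge0 ?sqr_ge0// mulr_ge0 ?sqr_ge0// NE subr_ge0.
  by rewrite ler_pXn2r// nnegrE// (le_trans a0).
have Mc : M * c = 6 * C by rewrite ME divfK ?gt_eqF.
apply: (@le_trans _ _ ((1 - s * d + C * d ^+ 2) * gain f)).
  by rewrite ler_wpM2r.
have h1 : (1 - s * d + C * d ^+ 2) * gain f <= (1 - s * d) * gain f + 2 * C * d ^+ 2.
  have : 0 <= C * d ^+ 2 * (2 - gain f).
    by rewrite mulr_ge0 ?subr_ge0// mulr_ge0 ?sqr_ge0 ?(ltW C0).
  lra.
have h2 : sg * (p * d * u + c * d ^+ 2) <=
  sg * (T * (1 + f) - 1 - f - p * (1 + eb) * d).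
  rewrite ler_wpM2l//.
  have : 0 <= c * d ^+ 2 * f by rewrite mulr_ge0 ?ei0// mulr_ge0 ?sqr_ge0 ?(ltW c0).
  have : (1 + p * d + c * d ^+ 2) * (1 + f) <= T * (1 + f).
    by rewrite ler_wpM2r// addr_ge0.
  by rewrite /u; lra.
(* The factor 6 in [M] is spent here: 2 C d^2 pays the loss in [h1] and C d^2 remains for [quad]. *)
have h3 : 3 * C * d ^+ 2 <= sg * (c * d ^+ 2).
  have : M / 2 * c * d ^+ 2 <= sg * c * d ^+ 2.
    by rewrite ler_wpM2r ?sqr_ge0// ler_pM2r.
  by rewrite (_ : M / 2 * c = 3 * C) ?mulrA//; lra.
apply: (le_trans h1).
apply: le_trans (lerD (lexx _) h2).
move: quad h3; rewrite /a /tau /gain /u.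
set x1 := sg * (c * _) => quad h3.
rewrite [sg * (_ + _)]mulrDr -/x1; lra.
Qed.

End bellman.

(** The region between the curves x^p and (1 + eps) x^p is not convex, so the mean point is also
    assumed to lie in it. Concavity is asked for [k] equal weights, as for the children of a
    cube. *)
Definition is_bellman (R : realType) (p s lam eps : R) (k : nat)
    (B : R -> R -> R) :=
  (forall x y, 0 < x -> x `^ p <= y <= (1 + eps) * x `^ p ->
    x `^ (- s) <= B x y <= lam * x `^ (- s)) /\
  (forall (I : finType) (x y : I -> R) (X Y : R), #|I| = k ->
    (forall i, 0 < x i) ->
    (forall i, x i `^ p <= y i <= (1 + eps) * x i `^ p) ->
    0 < X -> X `^ p <= Y <= (1 + eps) * X `^ p ->
    \sum_i x i = k%:R * X -> \sum_i y i = k%:R * Y ->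
    \sum_i B (x i) (y i) <= k%:R * B X Y).

(** Both bounds come from 1 <= gain <= lam on [0, eps]. Concavity reduces by homogeneity to mean 1:
    divide each [x i] by [X] and each [y i] by X^p. *)
Lemma bellman_function (R : realType) (p s lam : R) (k : nat) :
  1 < p -> 0 < s -> 1 < lam ->
  exists2 eps, 0 < eps & exists B, is_bellman p s lam eps k B.
Proof.
move=> p1 s0 lam1; have p0 : 0 < p by lra.
(* Positive ratios with mean 1 are at most their number [k]; the successor keeps the bound positive
   when [k] is 0. *)
have k0 : 0 < k.+1%:R :> R by [].
have [c c0 lower] := powR_quad_lower p1 k0.
have [C [theta [C0 th0 upper]]] := powRN_quad_upper s0.
have [M M0 ME] : exists2 M, 0 < M & M = 6 * C / c.
  by exists (6 * C / c) => //; rewrite divr_gt0//; lra.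
have [N N0 NE] : exists2 N, 0 < N & 4 * C * N = (M * (p + s)) ^+ 2.
  exists ((M * (p + s)) ^+ 2 / (4 * C)).
    by rewrite divr_gt0 ?exprn_gt0 ?mulr_gt0 ?addr_gt0.
  by rewrite mulrC divfK// gt_eqF// mulr_gt0.
(* In order, the bounds on [eps] give gain <= 2, chord slopes of at least M/2, ratios within [theta]
   of 1, and gain <= lam. *)
have [eps eps0] : exists2 eps, 0 < eps & [/\ eps <= M^-1, eps <= M / (4 * N),
    eps <= c * theta ^+ 2 / k.+1%:R & eps <= (lam - 1) / M].
  exists (Num.min (Num.min (M^-1) (M / (4 * N)))
    (Num.min (c * theta ^+ 2 / k.+1%:R) ((lam - 1) / M))).
    by rewrite !lt_min invr_gt0 M0 !divr_gt0 ?subr_gt0 ?mulr_gt0 ?exprn_gt0.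
  by split; rewrite !ge_min lexx ?orbT.
move=> [e1 e2 e3 e4].
have {}e1 : M * eps <= 1 by rewrite mulrC -ler_pdivlMr// div1r.
have {}e2 : 4 * N * eps <= M by rewrite mulrC -ler_pdivlMr ?mulr_gt0.
have {}e3 : k%:R * eps <= c * theta ^+ 2.
  rewrite (@le_trans _ _ (k.+1%:R * eps))// ?ler_wpM2r ?ler_nat// ?(ltW eps0)//.
  by rewrite mulrC -ler_pdivlMr.
have {}e4 : M * eps <= lam - 1 by rewrite mulrC -ler_pdivlMr.
have excess x y : 0 < x -> x `^ p <= y <= (1 + eps) * x `^ p ->
    0 <= y / x `^ p - 1 <= eps.
  move=> x0 /andP[xy yx]; have xp : 0 < x `^ p by rewrite powR_gt0.
  by rewrite subr_ge0 lerBlDl ler_pdivlMr// mul1r xy ler_pdivrMr.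
exists eps => //; exists (bellman p s M N); split.
  move=> x y x0 /(excess _ _ x0) /andP[]; rewrite /bellman /gain.
  set e := _ - 1 => e0 e1'; rewrite ler_peMr ?powR_ge0//=.
    by rewrite mulrC ler_wpM2r ?powR_ge0//; nra.
  have : 0 <= e * (M - 4 * N * e).
    rewrite mulr_ge0// subr_ge0 (le_trans _ e2)// ler_pM2l ?mulr_gt0//.
  by nra.
move=> I x y X Y kI x0 xy X0 XY sx sy.
pose t i := x i / X; pose e i := y i / x i `^ p - 1; pose E := Y / X `^ p - 1.
have xE i : x i = X * t i by rewrite /t mulrCA mulfV ?mulr1 ?gt_eqF.
have t0 i : 0 < t i by rewrite divr_gt0.
have Xp : 0 < X `^ p by rewrite powR_gt0.
rewrite (eq_bigr (fun i => X `^ (- s) * (t i `^ (- s) * gain M N (e i)))); last first.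
  by move=> i _; rewrite /bellman -/(e i) xE powRM ?ltW// mulrA.
rewrite -mulr_sumr /bellman mulrCA ler_wpM2l ?powR_ge0// -/E -kI.
apply: (@sum_bellman_normalized _ p s M N I c C theta eps t e E) => //.
- move=> u /andP[u0 uk]; apply: lower; rewrite u0 (le_trans uk)// ler_nat kI.
  by rewrite leqnSn.
- by move=> u /upper[].
- by rewrite kI.
- by move=> i; exact: excess.
- exact: excess.
- by rewrite -mulr_suml sx kI mulfK// gt_eqF.
rewrite (eq_bigr (fun i => y i / X `^ p)); last first.
  move=> i _; rewrite /e [1 + _]addrC subrK xE powRM ?(ltW X0) ?(ltW (t0 i))//.
  by field; rewrite !gt_eqF// powR_gt0.
by rewrite -mulr_suml sy kI -mulrA; congr (_ * _); rewrite /E; ring.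
Qed.

(** * Sums over dyadic subcubes *)

Section dyadic.
Context {R : realType} {n : nat}.
Implicit Types (a : n.-tuple R) (l : R) (sg : {ffun 'I_n -> bool}).
Local Notation mu := (@lebesgue R n).

Definition child a l sg : n.-tuple R :=
  [tuple tnth a i + (if sg i then l / 2 else 0) | i < n].

Lemma child_subset a l sg : 0 < l -> cube (child a l sg) (l / 2) `<=` cube a l.
Proof.
move=> l0 x xc i; have := xc i; rewrite tnth_mktuple.
by case: ifP => _ /andP[? ?]; apply/andP; split; lra.
Qed.

Lemma in_child a l x : cube a l x -> exists sg, cube (child a l sg) (l / 2) x.
Proof.
move=> xc; exists [ffun i => tnth a i + l / 2 <= tnth (x : n.-tuple R) i] => i.
have := xc i; rewrite tnth_mktuple ffunE.
case: ifPn => [h /andP[? ?]|]; first by apply/andP; split; lra.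
by rewrite -ltNge => h /andP[? ?]; apply/andP; split; lra.
Qed.

Lemma card_child : #|{ffun 'I_n -> bool}| = (2 ^ n)%N.
Proof. by rewrite card_ffun card_bool card_ord. Qed.

Local Open Scope ereal_scope.

(* The closed children cover the cube and their measures add up to its measure:
   this forces the overlaps to be null, without looking at the boundaries. *)
Lemma children_overlap a l : (0 < l)%R ->
  ae_eq mu (cube a l) (fun x => (\sum_sg (\1_(cube (child a l sg) (l / 2)) x : R))%R%:E)
    (cst 1).
Proof.
move=> l0; have l20 : (0 < l / 2)%R by rewrite divr_gt0.
pose c x : R := (\sum_sg \1_(cube (child a l sg) (l / 2)) x)%R.
have mc : measurable_fun setT c.
  by apply: measurable_sum => sg; exact/measurable_indic/measurable_cube.
have mC := measurable_cube a l.
have c1 x : cube a l x -> (1 <= c x)%R.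
  move=> /in_child[sg xsg]; rewrite /c (bigD1 sg)//= indicE mem_set//.
  by rewrite lerDl sumr_ge0.
have ic : \int[mu]_(x in cube a l) (c x)%:E = (l ^+ n)%:E.
  under eq_integral do rewrite -sumEFin.
  rewrite (ge0_integral_sum mu mC); last 2 first.
    by move=> sg; apply/measurable_EFinP/measurable_indic/measurable_cube.
    by move=> sg x _; rewrite lee_fin.
  rewrite (eq_bigr (fun=> ((l / 2) ^+ n)%:E)) => [|sg _].
    rewrite sumEFin sumr_const card_child -[(_ *+ (2 ^ n)%N)%R]mulr_natr natrX.
    by rewrite -exprMn divfK.
  rewrite integral_indic//; last exact: measurable_cube.
  by rewrite setIidl; [exact: lebesgue_cube|exact: child_subset].
have i1 : \int[mu]_(x in cube a l) (cst 1) x = (l ^+ n)%:E.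
  by rewrite integral_cst//= mul1e lebesgue_cube.
have d0 : \int[mu]_(x in cube a l) `|(c x)%:E - 1| = 0.
  under eq_integral => x /set_mem xC.
    rewrite gee0_abs; last by rewrite sube_ge0// lee_fin c1.
    over.
  rewrite integralB//=.
  - by rewrite ic i1 subee.
  - apply/integrableP; split; first exact/measurable_EFinP/measurable_funTS.
    under eq_integral => x xC do rewrite gee0_abs ?lee_fin ?sumr_ge0//.
    by rewrite ic ltry.
  - apply/integrableP; split; first exact: measurable_cst.
    by under eq_integral do rewrite gee0_abs//; rewrite [ltLHS]i1 ltry.
have : ae_eq mu (cube a l) (fun x => (c x)%:E - 1) (cst 0).
  apply/(ae_eq_integral_abs mu mC); last exact: d0.
  apply: emeasurable_funB; last exact: measurable_cst.
  exact/measurable_EFinP/measurable_funTS.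
apply: filterS => x h /h [/eqP]; rewrite subr_eq0 => /eqP cx1; congr EFin; exact: cx1.
Qed.

(** The indicators of the children sum to 1 almost everywhere, so [f] is almost everywhere the sum
    of its restrictions to them. *)
Lemma integral_children a l (f : euclidean R n -> \bar R) : (0 < l)%R ->
  measurable_fun (cube a l) f -> (forall x, cube a l x -> 0 <= f x) ->
  \int[mu]_(x in cube a l) f x =
  \sum_sg \int[mu]_(x in cube (child a l sg) (l / 2)) f x.
Proof.
move=> l0 mf f0; have mC := measurable_cube a l.
pose g sg x := f x * (\1_(cube (child a l sg) (l / 2)) x : R)%:E.
have mg sg : measurable_fun (cube a l) (g sg).
  apply: emeasurable_funM; first exact: mf.
  by apply/measurable_EFinP/measurable_indic/measurable_cube.
have gs sg : \int[mu]_(x in cube (child a l sg) (l / 2)) f x =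
    \int[mu]_(x in cube a l) g sg x.
  rewrite -{1}(setIidr (child_subset (a := a) (sg := sg) l0)).
  rewrite integral_mkcondr; apply: eq_integral => x _.
  rewrite /g patchE indicE; case: ifPn => _; by rewrite ?mule1 ?mule0.
under [RHS]eq_bigr do rewrite gs.
rewrite -(ge0_integral_sum mu mC mg); last first.
  by move=> sg x xC; rewrite mule_ge0// ?f0// lee_fin.
apply: (ae_eq_integral _ _ mC mf); first exact: emeasurable_sum.
apply: filterS (children_overlap a l0) => x h xC; rewrite /g.
rewrite -ge0_sume_distrr; last by move=> sg _; rewrite lee_fin.
by rewrite sumEFin h ?mule1.
Qed.

Fixpoint dyadic_sum (m : nat) (F : n.-tuple R -> R -> \bar R) a l : \bar R :=
  if m is m'.+1 then \sum_sg dyadic_sum m' F (child a l sg) (l / 2) else F a l.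

Lemma le_dyadic_sum m F G a l : (0 < l)%R ->
  (forall b k, (0 < k)%R -> cube b k `<=` cube a l -> F b k <= G b k) ->
  dyadic_sum m F a l <= dyadic_sum m G a l.
Proof.
elim: m a l => [|m ih] a l l0 FG /=; first by apply: FG.
apply: lee_sum => sg _; apply: ih => [|b k k0 bk]; first by rewrite divr_gt0.
by apply: FG => //; apply: subset_trans bk (child_subset l0).
Qed.

Lemma dyadic_sumD m F G a l :
  dyadic_sum m (fun b k => F b k + G b k) a l =
  dyadic_sum m F a l + dyadic_sum m G a l.
Proof.
elim: m a l => [//|m ih] a l /=; rewrite -big_split /=.
by apply: eq_bigr => sg _; exact: ih.
Qed.

Lemma dyadic_sumZ m (c : R) F a l : (0 < l)%R -> (forall b k, 0 <= F b k) ->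
  dyadic_sum m (fun b k => c%:E * F b k) a l = c%:E * dyadic_sum m F a l.
Proof.
move=> l0 F0; elim: m a l {l0} => [//|m ih] a l /=.
rewrite ge0_sume_distrr; first by apply: eq_bigr => sg _; exact: ih.
move=> sg _; elim: m {ih} (child a l sg) (l / 2)%R => [|m ih] b k //=.
by apply: sume_ge0.
Qed.

Lemma dyadic_sum_integral m a l (f : euclidean R n -> \bar R) : (0 < l)%R ->
  measurable_fun (cube a l) f -> (forall x, cube a l x -> 0 <= f x) ->
  dyadic_sum m (fun b k => \int[mu]_(x in cube b k) f x) a l =
  \int[mu]_(x in cube a l) f x.
Proof.
elim: m a l => [//|m ih] a l l0 mf f0 /=.
rewrite integral_children//; apply: eq_bigr => sg _; apply: ih.
- by rewrite divr_gt0.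
- by apply: measurable_funS mf; [exact: measurable_cube|exact: child_subset].
- by move=> x /(child_subset l0); exact: f0.
Qed.

Lemma dyadic_sum_measure m a l (A : set (euclidean R n)) : (0 < l)%R ->
  measurable A ->
  dyadic_sum m (fun b k => mu (cube b k `&` A)) a l = mu (cube a l `&` A).
Proof.
move=> l0 mA.
pose F b k := \int[mu]_(x in cube b k) (\1_A x)%:E.
have e : (fun b k => mu (cube b k `&` A)) = F.
  apply/funext => b; apply/funext => k.
  by rewrite /F (integral_indic _ (measurable_cube _ _) mA) setIC.
rewrite e [RHS](_ : _ = F a l); last by rewrite -e.
apply: dyadic_sum_integral; first exact: l0.
  exact/measurable_EFinP/measurable_indic.
by move=> x _; rewrite lee_fin.
Qed.

End dyadic.

(** * Density of the dyadic sets and functions *)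

Section approx.
Context {R : realType} {n : nat}.
Variables (a : n.-tuple R) (l : R).
Hypothesis l0 : 0 < l.
Local Notation mu := (@lebesgue R n).
Local Open Scope ereal_scope.

(** Monotonicity and subadditivity are inherited from the outer measure, hence hold for arbitrary
    sets. *)
Lemma le_lebesgue (A B : set (euclidean R n)) : A `<=` B -> mu A <= mu B.
Proof. exact: (@le_mu_ext _ _ _ (@borel_lebesgue R n)). Qed.

Lemma lebesgueU2 (A B : set (euclidean R n)) : mu (A `|` B) <= mu A + mu B.
Proof.
exact: (outer_measureU2 ((@borel_lebesgue R n)^*)%mu).
Qed.

(* [c b k = true] means that [cube b k] is kept in the dyadic approximation of
   [E]. *)
Definition miss (E : set (euclidean R n)) (c : n.-tuple R -> R -> bool) b k :=
  mu (cube b k `&` (if c b k then ~` E else E)).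

(** The error is small at every late generation, so that two approximations can be taken at a common
    one. The choice [c] may depend on the generation. *)
Definition dyadic_approximable (E : set (euclidean R n)) :=
  forall e : R, (0 < e)%R -> exists m0, forall m, (m0 <= m)%N ->
  exists c, dyadic_sum m (miss E c) a l <= e%:E.

Lemma dyadic_approximableC E :
  dyadic_approximable E -> dyadic_approximable (~` E).
Proof.
move=> aE e /aE[m0 h]; exists m0 => m /h[c cE].
exists (fun b k => ~~ c b k); apply: le_trans cE; apply: le_dyadic_sum => // b k _ _.
by rewrite /miss; case: (c b k); rewrite ?setCK.
Qed.

Lemma dyadic_approximableU E F : dyadic_approximable E ->
  dyadic_approximable F -> dyadic_approximable (E `|` F).
Proof.
move=> aE aF e e0; have e20 : (0 < e / 2)%R by rewrite divr_gt0.
have [m1 h1] := aE _ e20; have [m2 h2] := aF _ e20.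
exists (maxn m1 m2) => m; rewrite geq_max => /andP[/h1[c cE] /h2[d dF]].
exists (fun b k => c b k || d b k); rewrite [e]splitr EFinD.
apply: le_trans (leeD cE dF); rewrite -dyadic_sumD.
apply: le_dyadic_sum => // b k _ _; apply: le_trans (lebesgueU2 _ _).
apply: le_lebesgue => x []; case: (c b k) (d b k) => [] [] /= xc.
- by move=> h; left; split=> // xE; apply: h; left.
- by move=> h; left; split=> // xE; apply: h; left.
- by move=> h; right; split=> // xF; apply: h; right.
- by move=> [?|?]; [left|right].
Qed.

(** The cubes kept for [B] also serve [E]: the extra error on each cube lies in the symmetric
    difference, and these errors add up to its measure inside the large cube. *)
Lemma dyadic_approximable_close E : measurable E ->
  (forall e : R, (0 < e)%R -> exists B, [/\ measurable B, dyadic_approximable B &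
     mu (cube a l `&` ((E `\` B) `|` (B `\` E))) <= e%:E]) ->
  dyadic_approximable E.
Proof.
move=> mE h e e0; have e20 : (0 < e / 2)%R by rewrite divr_gt0.
have [B [mB /(_ _ e20)[m0 aB] EB]] := h _ e20.
exists m0 => m /aB[c cB]; exists c; rewrite [e]splitr EFinD.
have mD : measurable ((E `\` B) `|` (B `\` E)).
  by apply: measurableU; exact: measurableD.
apply: le_trans (leeD cB EB); rewrite -(dyadic_sum_measure m a l0 mD) -dyadic_sumD.
apply: le_dyadic_sum => // b k _ _; apply: le_trans (lebesgueU2 _ _).
apply: le_lebesgue => x; case: (c b k) => /= -[xc xE];
  have [xB|xB] := pselect (B x); try (by left); right; split=> //; by [left|right].
Qed.

Lemma dyadic_approximable0 : dyadic_approximable set0.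
Proof.
move=> e e0; exists 0%N => m _; exists (fun _ _ => false).
by rewrite /miss dyadic_sum_measure// setI0 measure0 lee_fin ltW.
Qed.

(** Finite unions are approximable, and what they miss of the countable union inside the cube
    shrinks to the empty set. Continuity from above applies because the cube has finite measure. *)
Lemma dyadic_approximable_bigcup (E : (set (euclidean R n))^nat) :
  (forall i, measurable (E i)) -> (forall i, dyadic_approximable (E i)) ->
  dyadic_approximable (\bigcup_i E i).
Proof.
move=> mE aE; pose U := \bigcup_i E i; pose F k := \big[setU/set0]_(i < k) E i.
have mU : measurable U by exact: bigcupT_measurable.
have mF k : measurable (F k) by exact: bigsetU_measurable.
have aF k : dyadic_approximable (F k).
  by apply: big_ind => //; [exact: dyadic_approximable0|exact: dyadic_approximableU].
have FU k : F k `<=` U.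
  by move=> x; rewrite /F -bigcup_mkord => -[i _ Ei]; exists i.
apply: dyadic_approximable_close => // e e0.
pose D k := cube a l `&` (U `\` F k).
have mD k : measurable (D k).
  by apply: measurableI; [exact: measurable_cube|exact: measurableD].
have D0 : \bigcap_k D k = set0.
  rewrite -subset0 => x xD; have [_ [[i _ Ei] _]] := xD 0%N I.
  have [_ [_]] := xD i.+1 I; apply.
  by rewrite /F -bigcup_mkord; exists i => //=.
have : mu (D k) @[k --> \oo] --> mu set0.
  rewrite -D0; apply: nonincreasing_cvg_mu.
  - apply: (@le_lt_trans _ _ (mu (cube a l))).
      by apply: (@le_lebesgue (D 0%N)) => x [].
    by rewrite lebesgue_cube// ltry.
  - exact: mD.
  - by apply: bigcapT_measurable.
  move=> i j ij; apply/subsetPset; apply: setIS; apply: setDS.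
  by apply: subset_bigsetU.
rewrite measure0 => /fine_cvgP[Dfin /cvgrPdist_le/(_ _ e0) De].
have [k _ /(_ k (leqnn k))[fk ek]] := filterI Dfin De.
exists (F k); split; [exact: mF|exact: aF|].
have -> : F k `\` U = set0 by rewrite -subset0 => x [/FU].
rewrite setU0 -/(D k) -(fineK fk) lee_fin.
by move: ek; rewrite sub0r normrN ger0_norm// fine_ge0// measure_ge0.
Qed.

(** Flipping bit [i] is an involution that exchanges the children with either value of that bit. *)
Lemma card_half_child (i : 'I_n) (b : bool) (x : R) :
  (2 * (\sum_(sg : {ffun 'I_n -> bool}) if sg i == b then x else 0) = 2 ^+ n * x)%R.
Proof.
pose flip (sg : {ffun 'I_n -> bool}) := [ffun j => if j == i then ~~ sg j else sg j].
have flipK : involutive flip.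
  by move=> sg; apply/ffunP => j; rewrite !ffunE; case: eqP => // _; rewrite negbK.
rewrite mulr_natl mulr2n {1}(reindex_inj (inv_inj flipK)) -big_split/=.
rewrite (eq_bigr (fun=> x)) => [|sg _].
  by rewrite sumr_const card_child -[LHS]mulr_natl natrX.
rewrite ffunE eqxx; case: (sg i) b => [] [] /=; by rewrite ?addr0 ?add0r.
Qed.

(** With one strict and one large inequality, the two halves of a side never straddle [r] both. *)
Definition straddle (i : 'I_n) (r : R) (b : n.-tuple R) (k : R) :=
  (tnth b i < r <= tnth b i + k)%R.

(* At most half of the children of a straddling cube straddle again, since
   the i-th bit of such a child is determined. *)
Lemma dyadic_sum_straddle i r m (b : n.-tuple R) k : (0 < k)%R ->
  dyadic_sum m (fun b' k' => (if straddle i r b' k' then k' ^+ n else 0)%R%:E) b k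
  <= (if straddle i r b k then 2^-1 ^+ m * k ^+ n else 0)%R%:E.
Proof.
elim: m b k => [|m ih] b k k0 /=; first by rewrite expr0 mul1r.
have k20 : (0 < k / 2)%R by rewrite divr_gt0.
apply: (@le_trans _ _ (\sum_(sg : {ffun 'I_n -> bool})
   (if straddle i r (child b k sg) (k / 2)
    then 2^-1 ^+ m * (k / 2) ^+ n else 0)%R%:E)).
  by apply: lee_sum => sg _; exact: ih.
rewrite sumEFin lee_fin.
case: ifPn => bk; last first.
  rewrite big1// => sg _; case: ifPn => // /andP[]; rewrite tnth_mktuple.
  move: bk; rewrite negb_and -leNgt -ltNge => /orP[]; case: ifP => _; lra.
pose v : R := (2^-1 ^+ m * (k / 2) ^+ n)%R.
have v0 : (0 <= v)%R by rewrite mulr_ge0 ?exprn_ge0 ?(ltW k20).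
apply: (@le_trans _ _ (\sum_(sg : {ffun 'I_n -> bool})
   if sg i == (tnth b i + k / 2 < r)%R then v else 0)%R).
  apply: ler_sum => sg _; rewrite -/v.
  case: ifPn => [/andP[]|_]; last by case: ifP.
  rewrite tnth_mktuple; case: (sg i) => h1 h2.
    by rewrite h1 eqxx.
  by rewrite ltNge (le_trans h2) ?addr0.
rewrite -(@ler_pM2l _ 2)// card_half_child exprS -mulrA mulVKf//.
by rewrite /v mulrCA -exprMn [(2 * _)%R]mulrC divfK.
Qed.

(** Keep the cubes lying entirely below [r]. Only straddling cubes contribute an error, and their
    total volume at generation m is at most l^n / 2^m. *)
Lemma dyadic_approximable_halfspace i (r : R) :
  dyadic_approximable [set x | tnth (x : n.-tuple R) i < r]%R.
Proof.
move=> e e0; set E := [set x | _].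
have : ((2^-1 ^+ m : R) * l ^+ n)%R @[m --> \oo] --> (0 * l ^+ n)%R.
  by apply: cvgMl; apply: cvg_expr; rewrite ger0_norm// invf_lt1// ltr1n.
rewrite mul0r => /cvgrPdist_le/(_ _ e0)[m0 _ hm].
exists m0 => m /hm/=; rewrite sub0r normrN => me.
exists (fun b k => tnth b i + k < r)%R.
apply: le_trans (_ : (2^-1 ^+ m * l ^+ n)%:E <= _); last first.
  by rewrite lee_fin (le_trans _ me)// ler_norm.
apply: (@le_trans _ _ (dyadic_sum m
  (fun b' k' => (if straddle i r b' k' then k' ^+ n else 0)%R%:E) a l)).
  apply: le_dyadic_sum => // b k k0 _; rewrite /miss; case: ifPn => bk.
    rewrite (_ : _ `&` _ = set0) ?measure0 ?lee_fin.
      by case: ifP => // _; rewrite exprn_ge0// ltW.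
    rewrite -subset0 => x [/(_ i)/andP[_ h]]; apply; exact: le_lt_trans h bk.
  rewrite -leNgt in bk; rewrite /straddle bk andbT; case: ifPn => rb.
    by rewrite -(lebesgue_cube b k0); apply: le_lebesgue => x [].
  rewrite (_ : _ `&` _ = set0) ?measure0//.
  rewrite -subset0 => x [/(_ i)/andP[h _]] h'; rewrite -leNgt in rb.
  by have := le_lt_trans (le_trans rb h) h'; rewrite ltxx.
apply: le_trans (dyadic_sum_straddle _ _ _ _ l0) _.
by rewrite lee_fin; case: ifP => // _; rewrite mulr_ge0 ?exprn_ge0 ?(ltW l0).
Qed.

Let good : set (set (euclidean R n)) :=
  [set E | measurable E /\ dyadic_approximable E].

Let goodC E : good E -> good (~` E).
Proof.
by move=> [mE aE]; split; [exact: measurableC|exact: dyadic_approximableC].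
Qed.

Let good0 : good set0.
Proof. by split; [exact: measurable0|exact: dyadic_approximable0]. Qed.

Let good_bigcup (E : (set (euclidean R n))^nat) :
  (forall i, good (E i)) -> good (\bigcup_i E i).
Proof.
move=> gE; split; first by apply: bigcupT_measurable => i; exact: (gE i).1.
by apply: dyadic_approximable_bigcup => // i; [exact: (gE i).1|exact: (gE i).2].
Qed.

(** The good sets form a sigma-algebra. The product sigma-algebra is generated by the preimages
    under coordinates, and these by the preimages of open rays, which are half-spaces. *)
Let good_borel (E : set (n.-tuple (measurableTypeR R))) : measurable E -> good E.
Proof.
apply: (smallest_sub (X := good)).
  by split => [//|A /goodC|//]; rewrite setTD.
apply: (big_ind (fun G => G `<=` good)) => [//|G H Gg Hg X []|i _ _ [B mB <-]].
- exact: Gg.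
- exact: Hg.
rewrite setTI.
pose P := [set B : set R | good ((fun x : n.-tuple R => tnth x i) @^-1` B)].
suff : P B by [].
have : (@RGenInftyO.G R).-sigma.-measurable B by rewrite -RGenInftyO.measurableE.
apply: (smallest_sub (X := P)).
  split; rewrite /P /=.
  - by rewrite preimage_set0.
  - by move=> A /goodC; rewrite setTD preimage_setC.
  - by move=> A gA; rewrite preimage_bigcup; exact: good_bigcup.
move=> _ [r ->]; rewrite /P /=; split; last first.
  rewrite (_ : _ @^-1` _ = [set x | tnth (x : n.-tuple R) i < r]%R).
    exact: dyadic_approximable_halfspace.
  by apply/seteqP; split=> x /=; rewrite in_itv.
apply: caratheodory_measurable_mu_ext.
rewrite -[X in measurable X]setTI.
by apply: measurable_tnth => //; exact: measurable_itv.
Qed.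

(** The outer measure is an infimum over countable Borel covers, so the part [E'] of [E] in the cube
    has a Borel superset [B] that exceeds it by at most [e] in measure. Within the cube, [E] and [B]
    differ only on [B] minus [E']. *)
Lemma dyadic_approximable_measurable (E : set (euclidean R n)) :
  measurable E -> dyadic_approximable E.
Proof.
move=> mE; apply: dyadic_approximable_close => // e e0.
pose E' := cube a l `&` E.
have mE' : measurable E' by apply: measurableI => //; exact: measurable_cube.
have E'fin : mu E' \is a fin_num.
  rewrite ge0_fin_numE ?measure_ge0//.
  apply: (@le_lt_trans _ _ (mu (cube a l))).
    by apply: (@le_lebesgue E') => x [].
  by rewrite lebesgue_cube// ltry.
have [_ [F [mF E'F] <-] Fe] := lb_ereal_inf_adherent e0 E'fin.
pose B : set (euclidean R n) := \bigcup_k F k.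
have mB : measurable (B : set (n.-tuple (measurableTypeR R))).
  exact: bigcupT_measurable.
have [mB' aB] := good_borel mB.
exists B; split => //.
apply: (@le_trans _ _ (mu (B `\` E'))).
  apply: le_lebesgue => x [xC [[xE xB]|[xB xE]]].
    by exfalso; apply: xB; apply: E'F; split.
  by split=> // -[].
have BE : mu B <= mu E' + e%:E.
  apply: le_trans (ltW Fe).
  have -> : mu B = borel_lebesgue B by exact: measurable_mu_extE.
  have : borel_lebesgue B <= \sum_(k <oo) borel_lebesgue (F k).
    by apply: measure_sigma_subadditive.
  exact.
rewrite (measureD mB' mE'); last first.
  by apply: le_lt_trans BE _; rewrite -(fineK E'fin) -EFinD ltry.
have E'B : E' `<=` B by exact: E'F.
by rewrite setIidr// leeBlDl// addeC.
Qed.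

End approx.

Lemma integral_normD_le d (T : measurableType d) (R : realType)
    (mu : {measure set T -> \bar R}) (D : set T) (u v h : T -> R) :
  measurable D -> measurable_fun D u -> measurable_fun D v -> measurable_fun D h ->
  (forall x, D x -> `|h x| <= `|u x| + `|v x|) ->
  (\int[mu]_(x in D) `|h x|%:E <=
   \int[mu]_(x in D) `|u x|%:E + \int[mu]_(x in D) `|v x|%:E)%E.
Proof.
move=> mD mu' mv mh huv.
have nm (f : T -> R) : measurable_fun D f -> measurable_fun D (fun x => `|f x|%:E).
  by move=> mf; apply/measurable_EFinP; exact: measurableT_comp.
rewrite -ge0_integralD//; [|exact: nm|exact: nm].
apply: ge0_le_integral => //.
- exact: nm.
- by apply: emeasurable_funD; exact: nm.
Qed.

(** * Approximation in L^1 by functions constant on dyadic cubes *)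

Section approx_fun.
Context {R : realType} {n : nat}.
Variables (a : n.-tuple R) (l : R).
Hypothesis l0 : 0 < l.
Local Notation mu := (@lebesgue R n).
Import HBSimple.

(** The constants are left free, which makes sums and multiples easy; [integral_dist_mean] later
    trades them for means at the cost of a factor 2. *)
Definition L1_dyadic_approximable (f : euclidean R n -> R) :=
  forall e : R, 0 < e -> exists m0, forall m, (m0 <= m)%N ->
  exists c : n.-tuple R -> R -> R,
  (dyadic_sum m (fun b k => \int[mu]_(x in cube b k) `|f x - c b k|%:E) a l
    <= e%:E)%E.

Lemma measurable_fun_cube b k (f : euclidean R n -> R) : cube b k `<=` cube a l ->
  measurable_fun (cube a l) f -> measurable_fun (cube b k) f.
Proof. by move=> bk; apply: measurable_funS => //; exact: measurable_cube. Qed.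

Lemma measurable_fun_dist D (f g : euclidean R n -> R) :
  measurable_fun D f -> measurable_fun D g ->
  measurable_fun D (fun x => `|f x - g x|%:E).
Proof.
move=> mf mg; apply/measurable_EFinP.
by apply: (measurableT_comp (@normr_measurable R setT) (measurable_funB mf mg)).
Qed.

Lemma L1_dyadic_approximableD f g :
  measurable_fun (cube a l) f -> measurable_fun (cube a l) g ->
  L1_dyadic_approximable f -> L1_dyadic_approximable g ->
  L1_dyadic_approximable (fun x => f x + g x).
Proof.
move=> mf mg af ag e e0; have e20 : 0 < e / 2 by rewrite divr_gt0.
have [m1 h1] := af _ e20; have [m2 h2] := ag _ e20.
exists (maxn m1 m2) => m; rewrite geq_max => /andP[/h1[c cf] /h2[d dg]].
exists (fun b k => c b k + d b k); rewrite [e]splitr EFinD.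
apply: le_trans (leeD cf dg); rewrite -dyadic_sumD.
apply: le_dyadic_sum => // b k _ bk.
have mf' := measurable_fun_cube bk mf; have mg' := measurable_fun_cube bk mg.
apply: (integral_normD_le _ (measurable_cube b k)
  (u := fun x => f x - c b k) (v := fun x => g x - d b k)).
- by apply: measurable_funB mf' _; exact: measurable_cst.
- by apply: measurable_funB mg' _; exact: measurable_cst.
- by apply: measurable_funB; [exact: measurable_funD|exact: measurable_cst].
by move=> x _; rewrite opprD addrACA ler_normD.
Qed.

Lemma L1_dyadic_approximableZ r f : measurable_fun (cube a l) f ->
  L1_dyadic_approximable f -> L1_dyadic_approximable (fun x => r * f x).
Proof.
(* Dividing by |r| + 1 instead of |r| covers r = 0. *)
move=> mf af e e0; have r0 : 0 < `|r| + 1 by rewrite ltr_wpDl.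
have [m0 h] := af _ (divr_gt0 e0 r0).
exists m0 => m /h[c cf]; exists (fun b k => r * c b k).
apply: (@le_trans _ _ (`|r|%:E * (e / (`|r| + 1))%:E)%E); last first.
  by rewrite -EFinM lee_fin mulrCA ger_pMr// ler_pdivrMr// mul1r lerDl.
apply: (le_trans _ (lee_wpmul2l _ cf)) => //.
rewrite -dyadic_sumZ//; last by move=> b k; apply: integral_ge0.
apply: le_dyadic_sum => // b k _ bk.
have mfc : measurable_fun (cube b k) (fun x => `|f x - c b k|%:E).
  apply: measurable_fun_dist; last exact: measurable_cst.
  exact: measurable_fun_cube mf.
rewrite -(ge0_integralZl_EFin mu (measurable_cube b k) _ mfc (normr_ge0 r)).
  rewrite le_eqVlt; apply/orP; left; apply/eqP; apply: eq_integral => x _.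
  by rewrite -mulrBr normrM EFinM.
by move=> x _; rewrite lee_fin.
Qed.

(** With the constant 1 on kept cubes and 0 on the others, the L^1 error on a cube is its [miss]. *)
Lemma L1_dyadic_approximable_indic (E : set (euclidean R n)) :
  measurable E -> L1_dyadic_approximable (\1_E : _ -> R).
Proof.
move=> mE e /(dyadic_approximable_measurable a l0 mE)[m0 h].
exists m0 => m /h[c cE]; exists (fun b k => (c b k)%:R).
apply: le_trans cE; apply: le_dyadic_sum => // b k _ _; rewrite /miss.
have mE' : measurable (if c b k then ~` E else E).
  by case: (c b k) => //; exact: measurableC.
rewrite setIC -(integral_indic _ (measurable_cube b k) mE').
rewrite le_eqVlt; apply/orP; left; apply/eqP; apply: eq_integral => x _.
congr EFin; case: (c b k); last by rewrite subr0 ger0_norm.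
rewrite !indicE in_setC; case: (_ \in _).
  by rewrite subrr normr0.
by rewrite sub0r normrN normr1.
Qed.

Lemma L1_dyadic_approximable_sfun (g : {sfun euclidean R n >-> R}) :
  L1_dyadic_approximable g.
Proof.
pose term y x : R := y * \1_(g @^-1` [set y]) x.
have mi y : measurable_fun (cube a l) (\1_(g @^-1` [set y]) : _ -> R).
  exact: measurable_indic.
have mt y : measurable_fun (cube a l) (term y).
  by apply: measurable_funM; [exact: measurable_cst|exact: mi].
have [s ->] : exists s : seq R, g = (fun x => \sum_(y <- s) term y x) :> (_ -> _).
  by eexists; apply/funext => x; rewrite fimfunE fsbig_finite.
elim: s => [|y s ih].
  move=> e e0; exists 0%N => m _; exists (fun _ _ => 0).
  under eq_fun do under eq_fun do under eq_integral do rewrite big_nil subrr normr0.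
  under eq_fun do under eq_fun do rewrite integral0.
  elim: m (a) (l) => [|m ih] b k /=; first by rewrite lee_fin ltW.
  rewrite big1 ?lee_fin ?(ltW e0)// => sg _.
  by elim: m {ih} (child b k sg) (k / 2) => [//|m ih] b' k' /=; rewrite big1.
under [X in L1_dyadic_approximable X]eq_fun do rewrite big_cons.
apply: (L1_dyadic_approximableD (mt y) (measurable_sum _ mt) _ ih).
by apply: (L1_dyadic_approximableZ _ (mi y)); exact: L1_dyadic_approximable_indic.
Qed.

Lemma L1_dyadic_approximable_integrable w : mu.-integrable (cube a l) (EFin \o w) ->
  L1_dyadic_approximable w.
Proof.
move=> iw e e0; have e20 : 0 < e / 2 by rewrite divr_gt0.
have mC := measurable_cube a l.
have mw : measurable_fun (cube a l) w by exact/measurable_EFinP/(measurable_int mu).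
have [g [ig _ /fine_cvgP[gfin /cvgrPdist_le/(_ _ e20) ge]]] :=
  approximation_sfun_integrable mC iw.
have [N _ /(_ N (leqnn N))[fN eN]] := filterI gfin ge.
have mg : measurable_fun (cube a l) (g N) by exact: measurable_funTS.
have {}eN : (\int[mu]_(x in cube a l) `|w x - g N x|%:E <= (e / 2)%:E)%E.
  move: eN; rewrite sub0r normrN -lee_fin; apply: le_trans.
  by rewrite -[leLHS](fineK fN) lee_fin ler_norm.
have [m0 h] := L1_dyadic_approximable_sfun (g N) e20.
exists m0 => m /h[c gc]; exists c; rewrite [e]splitr EFinD.
apply: le_trans (leeD eN gc).
rewrite -(dyadic_sum_integral m l0); last 2 first.
- exact: measurable_fun_dist.
- by move=> x _; rewrite lee_fin.
rewrite -dyadic_sumD; apply: le_dyadic_sum => // b k _ bk.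
have mw' := measurable_fun_cube bk mw; have mg' := measurable_fun_cube bk mg.
apply: (integral_normD_le _ (measurable_cube b k)
  (u := fun x => w x - g N x) (v := fun x => g N x - c b k)).
- exact: measurable_funB.
- by apply: measurable_funB; [exact: mg'|exact: measurable_cst].
- by apply: measurable_funB; [exact: mw'|exact: measurable_cst].
by move=> x _; rewrite (le_trans _ (ler_normD _ _))// addrA subrK.
Qed.

End approx_fun.

(** * Reverse Hölder weights *)

Section mean.
Context {R : realType} {n : nat}.
Implicit Types (b : n.-tuple R) (k : R).
Local Notation mu := (@lebesgue R n).

Definition mean (f : euclidean R n -> R) b k : R := fine (avg (EFin \o f) (cube b k)).

Lemma avg_cube (f : euclidean R n -> \bar R) b k : 0 < k ->
  avg f (cube b k) = ((k ^+ n)^-1%:E * \int[mu]_(x in cube b k) f x)%E.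
Proof. by move=> k0; rewrite /avg lebesgue_cube// inver gt_eqF// exprn_gt0. Qed.

Lemma integral_mean (f : euclidean R n -> R) b k : 0 < k ->
  avg (EFin \o f) (cube b k) \is a fin_num ->
  (\int[mu]_(x in cube b k) (f x)%:E = (k ^+ n * mean f b k)%:E)%E.
Proof.
move=> k0 fin; rewrite EFinM /mean fineK// avg_cube// muleA -EFinM.
by rewrite divff ?mul1e// gt_eqF// exprn_gt0.
Qed.

Lemma sum_mean_children (f : euclidean R n -> R) b k : 0 < k ->
  measurable_fun (cube b k) f -> (forall x, cube b k x -> 0 <= f x) ->
  avg (EFin \o f) (cube b k) \is a fin_num ->
  (forall sg, avg (EFin \o f) (cube (child b k sg) (k / 2)) \is a fin_num) ->
  \sum_sg mean f (child b k sg) (k / 2) = (2 ^ n)%:R * mean f b k.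
Proof.
move=> k0 mf f0 fin finc; have k20 : 0 < k / 2 by rewrite divr_gt0.
have k2n : (k / 2) ^+ n != 0 by rewrite expf_neq0// gt_eqF.
have : (k ^+ n * mean f b k)%:E =
    (\sum_sg ((k / 2) ^+ n * mean f (child b k sg) (k / 2))%:E)%E.
  rewrite -integral_mean// (integral_children k0).
  - by apply: eq_bigr => sg _; exact: integral_mean.
  - exact/measurable_EFinP.
  - by move=> x /f0; rewrite lee_fin.
rewrite sumEFin -mulr_sumr => -[h].
by apply: (mulfI k2n); rewrite -h mulrA natrX -exprMn divfK.
Qed.

Lemma integral_cst_cube b k (r : R) : 0 < k ->
  (\int[mu]_(x in cube b k) r%:E = (r * k ^+ n)%:E)%E.
Proof.
move=> k0; rewrite (integral_cst mu (measurable_cube b k)) EFinM.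
by congr (_ * _)%E; exact: lebesgue_cube.
Qed.

(** By the triangle inequality through [c]: the distance from [c] to the mean, times the volume, is
    itself at most the integral of |f - c|. *)
Lemma integral_dist_mean (f : euclidean R n -> R) b k (c : R) : 0 < k ->
  mu.-integrable (cube b k) (EFin \o f) ->
  (\int[mu]_(x in cube b k) `|f x - mean f b k|%:E <=
   2%:E * \int[mu]_(x in cube b k) `|f x - c|%:E)%E.
Proof.
move=> k0 intf; have mC := measurable_cube b k.
have mf : measurable_fun (cube b k) f by exact/measurable_EFinP/(measurable_int mu).
have fin : avg (EFin \o f) (cube b k) \is a fin_num.
  by rewrite avg_cube// fin_numM//; exact: integrable_fin_num.
have mfc : measurable_fun (cube b k) (fun x => f x - c).
  by apply: measurable_funB; [exact: mf|exact: measurable_cst].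
have ic : mu.-integrable (cube b k) (EFin \o cst c).
  apply/integrableP; split; first by apply/measurable_EFinP; exact: measurable_cst.
  by rewrite (integral_cst_cube b `|c| k0) ltry.
have h : ((`|c - mean f b k| * k ^+ n)%:E <=
    \int[mu]_(x in cube b k) `|f x - c|%:E)%E.
  apply: (le_trans _ (le_abse_integral mu mC (f := fun x => (f x - c)%:E) _)).
    rewrite (integralB_EFin mC intf ic) integral_mean// integral_cst_cube//.
    rewrite -EFinB [c * _]mulrC -mulrBr lee_fin normrM distrC mulrC.
    by rewrite [X in _ <= X * _]ger0_norm// exprn_ge0// ltW.
  exact/measurable_EFinP.
apply: (@le_trans _ _ (\int[mu]_(x in cube b k) `|f x - c|%:E +
   \int[mu]_(x in cube b k) `|c - mean f b k|%:E)%E).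
  apply: (integral_normD_le _ mC (u := fun x => f x - c)
    (v := fun=> c - mean f b k)).
  - exact: mfc.
  - exact: measurable_cst.
  - by apply: measurable_funB; [exact: mf|exact: measurable_cst].
  by move=> x _; rewrite (le_trans _ (ler_normD _ _))// addrA subrK.
rewrite integral_cst_cube// (_ : 2%:E = 1 + 1)%E// ge0_muleDl// !mul1e.
exact: leeD.
Qed.

End mean.

Section reverse_holder_facts.
Context {R : realType} {n : nat}.
Variables (p delta : R) (Q : set (euclidean R n)) (w : euclidean R n -> R).
Hypothesis p1 : 1 < p.
Hypothesis rh : reverse_holder p delta Q w.
Hypothesis cubeQ : is_cube Q.
Implicit Types (b : n.-tuple R) (k : R).
Local Notation mu := (@lebesgue R n).

Lemma rh_measurable b k : cube b k `<=` Q -> measurable_fun (cube b k) w.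
Proof.
move=> bQ; have [[mw _] _] := rh; apply: measurable_funS mw => //.
by have [a [l _ ->]] := cubeQ; exact: measurable_cube.
Qed.

Lemma rh_ge0 b k x : cube b k `<=` Q -> cube b k x -> 0 <= w x.
Proof. by move=> bQ /bQ; have [[_ w0] _] := rh; exact: w0. Qed.

(** Places the pair of means of w and w^p in the Bellman region: the lower curve is Jensen's
    inequality, the upper one the reverse Hölder bound raised to the power p. *)
Lemma rh_avg_fin b k : 0 < k -> cube b k `<=` Q ->
  [/\ avg (EFin \o w) (cube b k) \is a fin_num,
      avg (EFin \o (fun x => w x `^ p)) (cube b k) \is a fin_num,
      0 < mean w b k &
      mean w b k `^ p <= mean (fun x => w x `^ p) b k
        <= delta `^ p * mean w b k `^ p].
Proof.
pose wp x := w x `^ p; rewrite -/wp.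
move=> k0 bQ; have [[_ w0] /(_ _ _ bQ)] := rh.
have kn0 : 0 < k ^+ n by rewrite exprn_gt0.
move=> /(_ _)/wrap[]; first by exists b, k.
rewrite (_ : (fun x => epow (w x)%:E p) = EFin \o wp); last first.
  by apply/funext => x; rewrite /epow ltNge (le_trans ler01 (ltW p1)).
move=> [/andP[A0 Ay]].
have fA : avg (EFin \o w) (cube b k) \is a fin_num by rewrite ge0_fin_numE// ltW.
have X0 : 0 < mean w b k by rewrite fine_gt0// A0 Ay.
rewrite /epow invr_lt0 ltNge (le_trans ler01 (ltW p1))/=.
have Ap0 : (0 <= avg (EFin \o wp) (cube b k))%E.
  rewrite avg_cube// mule_ge0 ?lee_fin ?invr_ge0 ?(ltW kn0)//.
  by apply: integral_ge0 => x _; rewrite lee_fin powR_ge0.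
rewrite -(fineK fA) -/(mean w b k) inver gt_eqF//.
move=> h.
(* An infinite mean of w^p would make the quotient in [h] infinite, hence larger than [delta]. *)
have fAp : avg (EFin \o wp) (cube b k) \is a fin_num.
  rewrite ge0_fin_numE// ltey; apply/negP => /eqP E; move: h; rewrite E.
  rewrite poweRyr ?invr_eq0 ?gt_eqF ?(lt_trans ltr01)//.
  by rewrite gt0_mulye ?lte_fin ?invr_gt0// leye_eq.
split => //; apply/andP; split; last first.
  move: h; rewrite -(fineK fAp) -/(mean wp b k) poweR_EFin -EFinM lee_fin.
  rewrite ler_pdivrMr// => h.
  have Y0 : 0 <= mean wp b k by rewrite fine_ge0.
  have p0 : 0 < p by apply: lt_trans p1.
  have d0 : 0 <= delta.
    by rewrite -(pmulr_lge0 _ X0) (le_trans _ h)// powR_ge0.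
  rewrite -powRM// ?(ltW X0)//.
  have -> : mean wp b k = (mean wp b k `^ p^-1) `^ p.
    by rewrite -powRrM mulVf ?powRr1// gt_eqF.
  by apply: ge0_ler_powR; rewrite ?nnegrE ?powR_ge0 ?mulr_ge0 ?(ltW X0) ?(ltW p0).
have mC := measurable_cube b k.
have mw := rh_measurable bQ.
have mwp : measurable_fun (cube b k) wp.
  exact: (measurableT_comp (@measurable_powR R p) mw).
set X := mean w b k in X0 *; set r := X `^ p.
have r0 : 0 < r by rewrite powR_gt0.
have c0 : 0 <= p * r / X by rewrite divr_ge0 ?mulr_ge0 ?(ltW X0) ?(ltW r0) ?(ltW (lt_trans ltr01 p1)).
have c1 : 0 <= (p - 1) * r by rewrite mulr_ge0 ?(ltW r0)// subr_ge0 ltW.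
(* Jensen's inequality, by integrating the tangent bound at X. *)
have : (\int[mu]_(x in cube b k) ((p * r / X)%:E * (w x)%:E) <=
    \int[mu]_(x in cube b k) ((wp x)%:E + ((p - 1) * r)%:E))%E.
  apply: (@ge0_le_integral _ _ _ mu _ mC).
  - by move=> x /(rh_ge0 bQ) wx; rewrite mule_ge0 ?lee_fin.
  - by apply: emeasurable_funM; [exact: measurable_cst|exact/measurable_EFinP].
  - by apply: emeasurable_funD; [exact/measurable_EFinP|exact: measurable_cst].
  move=> x /(rh_ge0 bQ) wx; rewrite -EFinM -EFinD lee_fin.
  have u0 : 0 <= w x / X by rewrite divr_ge0 ?(ltW X0).
  have := powR_ge_tangent u0 (ltW p1).
  rewrite -[_ <= _](ler_pM2r r0) -(powRM _ u0 (ltW X0)) divfK ?gt_eqF// -/(wp x).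
  set W := w x; set V := wp x.
  have -> : p * r / X * W = p * (W / X) * r by field; rewrite gt_eqF.
  lra.
have mEw : measurable_fun (cube b k) (EFin \o w) by exact/measurable_EFinP.
have mEwp : measurable_fun (cube b k) (EFin \o wp) by exact/measurable_EFinP.
have mEc : measurable_fun (cube b k) (EFin \o cst ((p - 1) * r)).
  by apply/measurable_EFinP; exact: measurable_cst.
have Ew0 x : cube b k x -> (0 <= (w x)%:E)%E by move=> /(rh_ge0 bQ); rewrite lee_fin.
have wp0 x : cube b k x -> (0 <= (wp x)%:E)%E by rewrite lee_fin powR_ge0.
rewrite (ge0_integralZl_EFin mu mC Ew0 mEw c0).
rewrite (ge0_integralD mu mC wp0 mEwp (fun _ _ => c1 : (0 <= ((p - 1) * r)%:E)%E) mEc).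
rewrite (integral_mean k0 fA) (integral_mean k0 fAp).
have -> := integral_cst_cube b ((p - 1) * r) k0.
rewrite -EFinM -EFinD lee_fin.
rewrite -/X; set Y := mean wp b k.
have -> : p * r / X * (k ^+ n * X) = k ^+ n * (p * r) by field; rewrite gt_eqF.
rewrite [(p - 1) * r * _]mulrC -mulrDr ler_pM2l//; lra.
Qed.


Lemma rh_integrable b k : 0 < k -> cube b k `<=` Q ->
  mu.-integrable (cube b k) (EFin \o w).
Proof.
move=> k0 bQ; apply/integrableP; split.
  by apply/measurable_EFinP; exact: rh_measurable.
under eq_integral => x xC.
  rewrite gee0_abs; last by rewrite lee_fin (rh_ge0 bQ)//; exact: set_mem.
  over.
by have [fA _ _ _] := rh_avg_fin k0 bQ; rewrite integral_mean// ltry.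
Qed.

(** Let [P] be the volume of a cube times [B] at its means. Its sum over the children is at most its
    value at the parent, by concavity, so induction bounds every generation; the sandwich on [B]
    then turns [P] into powers of the mean, with the factor [lam] paid only once. *)
Lemma rh_dyadic_sum_powRN (s eps lam : R) (B : R -> R -> R) m b k :
  delta `^ p = 1 + eps -> is_bellman p s lam eps (2 ^ n) B ->
  0 < k -> cube b k `<=` Q ->
  (dyadic_sum m (fun b k => (k ^+ n * mean w b k `^ (- s))%:E) b k <=
    (lam * (k ^+ n * mean w b k `^ (- s)))%:E)%E.
Proof.
move=> deltaE [Bbound Bconcave]; pose wp x := w x `^ p.
pose P b k := k ^+ n * B (mean w b k) (mean wp b k).
have PB b' k' : 0 < k' -> cube b' k' `<=` Q ->
    k' ^+ n * mean w b' k' `^ (- s) <= P b' k' <=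
    lam * (k' ^+ n * mean w b' k' `^ (- s)).
  move=> k0 bQ; have [_ _ X0] := rh_avg_fin k0 bQ; rewrite deltaE.
  move=> /(Bbound _ _ X0)/andP[h1 h2]; have kn : 0 < k' ^+ n by rewrite exprn_gt0.
  by rewrite /P mulrCA !ler_pM2l// h1.
have main : forall b k, 0 < k -> cube b k `<=` Q ->
    (dyadic_sum m (fun b k => (P b k)%:E) b k <= (P b k)%:E)%E.
  elim: m => [//|m ih] b' k' k0 bQ /=.
  have k20 : 0 < k' / 2 by rewrite divr_gt0.
  have cQ sg : cube (child b' k' sg) (k' / 2) `<=` Q.
    exact: subset_trans (child_subset k0) bQ.
  apply: (@le_trans _ _ (\sum_sg (P (child b' k' sg) (k' / 2))%:E)%E).
    by apply: lee_sum => sg _; exact: ih.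
  have [fA fAp X0 XY] := rh_avg_fin k0 bQ.
  have mw := rh_measurable bQ.
  have mwp : measurable_fun (cube b' k') wp.
    exact: (measurableT_comp (@measurable_powR R p) mw).
  rewrite sumEFin lee_fin /P -mulr_sumr.
  have -> : k' ^+ n = (k' / 2) ^+ n * (2 ^ n)%:R.
    by rewrite natrX -exprMn divfK.
  rewrite -mulrA ler_pM2l ?exprn_gt0//.
  rewrite deltaE in XY; apply: Bconcave.
  - exact: card_child.
  - by move=> sg; have [] := rh_avg_fin k20 (cQ sg).
  - by move=> sg; have [_ _ _] := rh_avg_fin k20 (cQ sg); rewrite deltaE.
  - exact: X0.
  - exact: XY.
  - apply: (sum_mean_children k0 mw _ fA); first by move=> x /(rh_ge0 bQ).
    by move=> sg; have [] := rh_avg_fin k20 (cQ sg).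
  - apply: (sum_mean_children k0 mwp _ fAp); first by move=> x _; exact: powR_ge0.
    by move=> sg; have [] := rh_avg_fin k20 (cQ sg).
move=> k0 bQ; apply: (@le_trans _ _ (P b k)%:E); last first.
  by rewrite lee_fin; case/andP: (PB _ _ k0 bQ).
apply: le_trans (main _ _ k0 bQ); apply: le_dyadic_sum => // b' k' k'0 b'b.
by rewrite lee_fin; case/andP: (PB _ _ k'0 (subset_trans b'b bQ)).
Qed.

(** On each dyadic cube the truncated power of w is at most the power of the mean plus a Lipschitz
    multiple of the distance from w to its mean. The latter terms sum to an L^1 error that vanishes
    as the generation grows. *)
Lemma rh_integral_trunc (s e A : R) b k : 0 < s -> 0 < e -> 0 < k ->
  cube b k `<=` Q ->
  (forall m, dyadic_sum m (fun b k => (k ^+ n * mean w b k `^ (- s))%:E) b k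
     <= A%:E)%E ->
  (\int[mu]_(x in cube b k) (Num.max (w x) e `^ (- s))%:E <= A%:E)%E.
Proof.
move=> s0 e0 k0 bQ bound; apply/lee_addgt0Pr => d d0.
pose L := s * e `^ (- s) / e.
have L0 : 0 < L by rewrite divr_gt0 ?mulr_gt0 ?powR_gt0.
have L20 : 0 < L * 2 by apply: mulr_gt0.
(* [L] is the Lipschitz constant of the truncated power; the 2 is the price of replacing the
   approximating constants by means. *)
have d'0 : 0 < d / (L * 2) by apply: divr_gt0.
have [m0 /(_ m0 (leqnn _))[c wc]] :=
  L1_dyadic_approximable_integrable k0 (rh_integrable k0 bQ) d'0.
have mphi : measurable_fun setT (fun v : R => (Num.max v e `^ (- s))%:E).
  apply/measurable_EFinP; apply: (measurableT_comp (@measurable_powR R (- s))).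
  by apply: measurable_maxr; [exact: measurable_id|exact: measurable_cst].
have mf : measurable_fun (cube b k) (fun x => (Num.max (w x) e `^ (- s))%:E).
  exact: (measurableT_comp mphi (rh_measurable bQ)).
rewrite -(dyadic_sum_integral m0 k0 mf); last first.
  by move=> x _; rewrite lee_fin powR_ge0.
apply: (@le_trans _ _ (A%:E + (L * 2)%:E * (d / (L * 2))%:E)%E); last first.
  by rewrite -EFinM mulrCA divff ?mulr1// gt_eqF.
apply: (le_trans _ (leeD (bound m0) (lee_wpmul2l _ wc))); last first.
  by rewrite lee_fin ltW.
rewrite -(dyadic_sumZ _ _ _ k0); last by move=> *; apply: integral_ge0.
rewrite -dyadic_sumD; apply: le_dyadic_sum => // b' k' k'0 b'b.
have b'Q := subset_trans b'b bQ.
have mC := measurable_cube b' k'.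
have [fA _ X0 _] := rh_avg_fin k'0 b'Q.
have mw := rh_measurable b'Q.
have md : measurable_fun (cube b' k') (fun x => `|w x - mean w b' k'|%:E).
  by apply: measurable_fun_dist; [exact: mw|exact: measurable_cst].
have int_dist := integral_dist_mean (c b' k') k'0 (rh_integrable k'0 b'Q).
set X := mean w b' k' in X0 md int_dist *.
apply: (@le_trans _ _ (\int[mu]_(x in cube b' k')
    ((X `^ (- s))%:E + L%:E * `|w x - X|%:E))%E).
  apply: (@ge0_le_integral _ _ _ mu _ mC).
  - by move=> x _; rewrite lee_fin powR_ge0.
  - exact: (measurableT_comp mphi mw).
  - apply: emeasurable_funD; first exact: measurable_cst.
    by apply: emeasurable_funM; [exact: measurable_cst|exact: md].
  by move=> x _; rewrite -EFinM -EFinD lee_fin; exact: powRN_max_le.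
rewrite (@ge0_integralD _ _ _ mu _ mC); last 4 first.
- by move=> x _; rewrite lee_fin powR_ge0.
- exact: measurable_cst.
- by move=> x _; rewrite mule_ge0// lee_fin ltW.
- by apply: emeasurable_funM; [exact: measurable_cst|exact: md].
have d0' x : cube b' k' x -> (0 <= `|w x - X|%:E)%E by rewrite lee_fin.
rewrite (ge0_integralZl_EFin mu mC d0' md (ltW L0)).
apply: leeD; first by rewrite integral_cst_cube// mulrC.
by rewrite [(L * 2)%:E]EFinM -muleA; apply: lee_wpmul2l int_dist; rewrite lee_fin ltW.
Qed.

End reverse_holder_facts.

(** * Removal of the truncation *)

Lemma cvg_powRN_max (R : realType) (s v : R) : 0 < s -> 0 <= v ->
  (Num.max v j.+1%:R^-1 `^ (- s))%:E @[j --> \oo] --> epow v%:E (- s).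
Proof.
move=> s0 v0; rewrite /epow oppr_lt0 s0 opprK poweR_EFin inver.
case: ifPn => [|]; rewrite powR_eq0 (gt_eqF s0) andbT; last first.
  move=> vn0; have {v0 vn0}v0 : 0 < v by rewrite lt_neqAle eq_sym vn0.
  (* For v > 0 the truncation is inactive as soon as 1/(j + 1) <= v. *)
  rewrite -powRN; apply: cvg_near_cst; near=> j.
  congr EFin; congr powR; apply/max_idPl.
  rewrite invf_ple ?posrE// (le_trans (ltW (truncnS_gt _)))// ler_nat.
  by rewrite ltnS; near: j; exact: nbhs_infty_ge.
(* At v = 0 the values are (j + 1)^s, which tend to the conventional value +oo of the negative
   power. *)
move=> /eqP ->; apply/cvgeryP/cvgryPge => A; near=> j.
have j0 : 0 < j.+1%:R^-1 :> R by rewrite invr_gt0.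
rewrite (max_idPr (ltW j0)) powRN powRV// invrK.
have [A0|A0] := leP A 0; first by rewrite (le_trans A0)// powR_ge0.
have -> : A = (A `^ s^-1) `^ s.
  by rewrite -powRrM mulVf ?powRr1 ?(ltW A0) ?gt_eqF.
rewrite ge0_ler_powR ?nnegrE ?powR_ge0 ?(ltW s0)//.
rewrite (le_trans (ltW (truncnS_gt _)))// ler_nat ltnS.
by near: j; exact: nbhs_infty_ge.
Unshelve. all: by end_near. Qed.

(** The powers truncated at 1/(j + 1) increase with j, so monotone convergence carries their uniform
    bound to the limit, including where w vanishes. *)
Lemma integral_epow_le d (T : measurableType d) (R : realType)
    (mu : {measure set T -> \bar R}) (D : set T) (w : T -> R) (s A : R) :
  measurable D -> measurable_fun D w -> (forall x, D x -> 0 <= w x) -> 0 < s ->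
  (forall e, 0 < e ->
    (\int[mu]_(x in D) (Num.max (w x) e `^ (- s))%:E <= A%:E)%E) ->
  (\int[mu]_(x in D) epow (w x)%:E (- s) <= A%:E)%E.
Proof.
move=> mD mw w0 s0 bound.
pose g j x := (Num.max (w x) j.+1%:R^-1 `^ (- s))%:E.
have mg j : measurable_fun D (g j).
  have mphi : measurable_fun setT (fun v : R => (Num.max v j.+1%:R^-1 `^ (- s))%:E).
    apply/measurable_EFinP; apply: (measurableT_comp (@measurable_powR R (- s))).
    by apply: measurable_maxr; [exact: measurable_id|exact: measurable_cst].
  exact: (measurableT_comp mphi mw).
have g0 j x : D x -> (0 <= g j x)%E by rewrite lee_fin powR_ge0.
have gnd x : D x -> {homo g^~ x : i j / (i <= j)%N >-> (i <= j)%E}.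
  move=> _ i j ij; rewrite lee_fin powRN_antitone//.
    by rewrite lt_max invr_gt0 ltr0n orbT.
  by rewrite ge_max !le_max lexx lef_pV2 ?posrE// ler_nat ltnS ij orbT.
have := cvg_monotone_convergence mD mg g0 gnd (mu := mu).
rewrite (eq_integral (fun x => epow (w x)%:E (- s))) => [cv|x /set_mem xD]; last first.
  by apply/cvg_lim => //; apply: cvg_powRN_max => //; exact: w0.
rewrite -(cvg_lim _ cv)//; apply: lime_le; first by apply/cvg_ex; eexists; exact: cv.
by near=> j; apply: bound; rewrite invr_gt0.
Unshelve. all: by end_near. Qed.

(** * Choice of [delta] and passage from the mean of w^(-s) to the A_q bound *)

Theorem theorem4 (R : realType) (n : nat) (hn : (1 < n)%N)
    (Q : set (euclidean R n)) (hQ : is_cube Q)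
    (p q eta : R) (hp : 1 < p) (hq : 1 < q) (heta : 1 < eta) :
  exists2 delta : R, 1 < delta &
    forall w : euclidean R n -> R, reverse_holder p delta Q w ->
    forall K : set (euclidean R n), is_cube K -> K `<=` Q ->
      (avg (EFin \o w) K *
       epow (avg (fun x => epow (w x)%:E (1 - conjugate_exponent q)) K) (q - 1)
       <= eta%:E)%E.
Proof.
have q0 : 0 < q - 1 by rewrite subr_gt0.
pose s := (q - 1)^-1; have s0 : 0 < s by rewrite invr_gt0.
have p0 : 0 < p := lt_trans ltr01 hp.
have -> : 1 - conjugate_exponent q = - s.
  by rewrite /conjugate_exponent /s; field; rewrite gt_eqF.
(* The loss factor is eta^s because the A_q condition raises the mean of w^(-s) to the power q - 1 =
   1/s, which turns it into [eta]. *)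
have lam1 : 1 < eta `^ s by exact: powR_gt1.
have [eps eps0 [B bellmanB]] := bellman_function (2 ^ n) hp s0 lam1.
(* Chosen so that delta^p = 1 + eps, the width of the Bellman region. *)
exists ((1 + eps) `^ p^-1).
  by rewrite powR_gt1 ?invr_gt0 ?ltrDl.
move=> w rh _ [a [l l0 ->]] KQ.
have deltaE : ((1 + eps) `^ p^-1) `^ p = 1 + eps.
  by rewrite -powRrM mulVf ?gt_eqF// powRr1// addr_ge0// ltW.
have bound m := rh_dyadic_sum_powRN hp rh hQ m deltaE bellmanB l0 KQ.
have [fA _ X0 _] := rh_avg_fin hp rh hQ l0 KQ.
set X := mean w a l in X0 bound.
have mC := measurable_cube a l.
have := integral_epow_le mC (rh_measurable rh hQ KQ) _ s0
  (fun e e0 => rh_integral_trunc hp rh hQ s0 e0 l0 KQ bound).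
move=> /(_ (fun x => rh_ge0 rh KQ)) int_le.
have avg_le : (avg (fun x => epow (w x)%:E (- s)) (cube a l) <=
    (eta `^ s * X `^ (- s))%:E)%E.
  rewrite avg_cube// lee_pdivrMl ?exprn_gt0// (le_trans int_le)//.
  by rewrite -EFinM lee_fin mulrCA.
have avg_ge0 : (0 <= avg (fun x => epow (w x)%:E (- s)) (cube a l))%E.
  rewrite avg_cube// mule_ge0 ?lee_fin ?invr_ge0 ?exprn_ge0 ?(ltW l0)//.
  apply: integral_ge0 => x _; rewrite /epow oppr_lt0 s0 inve_ge0.
  exact: poweR_ge0.
rewrite {1}/epow ltNge (ltW q0)/= -(fineK fA) -/(mean w a l) -/X.
(* Raised to q - 1, the factor X^(-s) becomes 1/X and cancels the mean of w. *)
apply: (@le_trans _ _ (X%:E * ((eta `^ s * X `^ (- s)) `^ (q - 1))%:E)%E).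
  rewrite lee_pmul2l// -poweR_EFin gt0_ler_poweR// ?(ltW q0)// in_itv/= leey andbT//.
  by rewrite lee_fin mulr_ge0// powR_ge0.
rewrite -EFinM lee_fin powRM ?powR_ge0// -!powRrM mulNr mulVf ?gt_eqF//.
rewrite powRr1 ?(le_trans ler01 (ltW heta))// powR_inv1 ?(ltW X0)//.
by rewrite mulrCA divff ?mulr1// gt_eqF.
Qed.
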